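(* Let $k\ge0$ and let $\tilde{\mathbf w}=(\tilde u,\tilde q)'$ with $\tilde u,\tilde q\in C^1([0,T];V^k\cap L^2(\mathbb R))$ be a solution of the LDG method (defined in the context). Then $$\|\tilde u(\cdot,T)\|^2_{L^2(\mathbb R)}+2\|\tilde q\|^2_{L^2(\mathbb R\times(0,T))}+2\Theta_T[\tilde{\mathbf w}]+b\,c_\lambda\int_0^T|\tilde u(\cdot,t)|^2_{H^{\lambda/2}(\mathbb R)}\,dt\le\|u_0\|^2_{L^2(\mathbb R)},$$ where $\Theta_T[\mathbf w]=\int_0^T\sum_{i\in\mathbb Z}[\mathbf w_i]'\,\mathbb C\,[\mathbf w_i]\,dt\ (\ge0)$.
   Context: Problem: $u_t+f(u)_x=(a(u)u_x)_x+b\mathcal L[u]$ on $\mathbb R\times(0,T)$, $u(\cdot,0)=u_0\in L^2(\mathbb R)$, with $f,a$ Lipschitz, $a\ge0$ bounded, $f(0)=0$, $b\ge0$. For $\lambda\in(0,1)$, $c_\lambda>0$: $\mathcal L[u](x)=c_\lambda\int_{|z|>0}\frac{u(x+z)-u(x)}{|z|^{1+\lambda}}dz$; $|u|^2_{H^{\lambda/2}}=\int\int\frac{(u(z)-u(x))^2}{|z-x|^{1+\lambda}}dz\,dx$; for $u,v\in H^{\lambda/2}(\mathbb R)$, $\int v\mathcal L[u]:=-\frac{c_\lambda}{2}\int\int\frac{(v(z)-v(x))(u(z)-u(x))}{|z-x|^{1+\lambda}}dz\,dx$ (and $V^k\cap L^2\subset H^{\lambda/2}$). Grid: $x_i=i\Delta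 x$, $I_i=(x_i,x_{i+1})$; $V^k$ = piecewise polynomials of degree $\le k$ on the cells $I_i$; $p_i^\pm=p(x_i^\pm)$, $[p_i]=p_i^+-p_i^-$, $\overline{p_i}=\frac12(p_i^++p_i^-)$. For vectors $\mathbf w=(u,q)'$, $[\mathbf w_i]=([u_i],[q_i])'$. Let $g(u)=\int_0^u\sqrt{a(s)}ds$, $F(u)=\int_0^uf(s)ds$, $h_u(\mathbf w)=f(u)-\sqrt{a(u)}q$, $h_q(u)=-g(u)$. Let $\hat f$ be a Lipschitz, consistent, monotone (nondecreasing in 1st, nonincreasing in 2nd argument) flux. Set $c_{11}=\frac1{[u_i]}\big(\frac{[F(u_i)]}{[u_i]}-\hat f(u_i^-,u_i^+)\big)$ (ratios extended by continuity when $[u_i]=0$; $c_{11}\ge0$), let $c_{12}=c_{12}(\mathbf w_i^-,\mathbf w_i^+)$ be Lipschitz with $c_{12}=0$ when $a=0$ or $\mathbf w_i^\pm=0$, and $\mathbb C=\begin{pmatrix}c_{11}&c_{12}\\-c_{12}&0\end{pmatrix}$. Numerical fluxes: $\hat h_u(\mathbf w_i)=\frac{[F(u_i)]}{[u_i]}-\frac{[g(u_i)]}{[u_i]}\overline{q_i}-c_{11}[u_i]-c_{12}[q_i]$, $\hat h_q(u_i)=-\overline{g(u_i)}+c_{12}[u_i]$. LDG method: find $\tilde u(\cdot,t),\tilde q(\cdot,t)\in V^k$ such that for all $i$ and all polynomials $v_u,v_q$ of degree $\le k$ on $I_i$: $\int_{I_i}\tilde u_tv_u-\int_{I_i}h_u(\tilde{\mathbf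 w})\partial_xv_u+\hat h_u(\tilde{\mathbf w}_{i+1})v_{u,i+1}^--\hat h_u(\tilde{\mathbf w}_i)v_{u,i}^+=b\int_{I_i}\mathcal L[\tilde u]v_u$, $\int_{I_i}\tilde qv_q-\int_{I_i}h_q(\tilde u)\partial_xv_q+\hat h_q(\tilde u_{i+1})v_{q,i+1}^--\hat h_q(\tilde u_i)v_{q,i}^+=0$, with $\int_{I_i}\tilde u(x,0)v=\int_{I_i}u_0v$ for all such $v$. *)

(* Defs.v *)
From HB Require Import structures.
From mathcomp Require Import all_boot all_order all_algebra.
From mathcomp Require Import all_classical all_reals all_analysis.

Set Implicit Arguments.
Unset Strict Implicit.
Unset Printing Implicit Defensive.
Import Order.TTheory GRing.Theory Num.Theory.
Import numFieldNormedType.Exports.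

Local Open Scope classical_set_scope.
Local Open Scope ring_scope.

Section LDG.
Variable R : realType.

Local Notation leb := (@lebesgue_measure R).

Definition xg (dx : R) (i : int) : R := i%:~R * dx.

Definition cellI (dx : R) (i : int) : set R := `]xg dx i, xg dx (i + 1)[.

(* index of the cell containing x (grid points are attributed to the cell on
   their right; this is a null set and irrelevant for all integrals) *)
Definition cell_of (dx : R) (x : R) : int := Num.floor (x / dx).

(* an element of V^k is given by one polynomial per cell *)
Definition Vk (k : nat) (U : int -> {poly R}) : Prop :=
  forall i, (size (U i) <= k.+1)%N.

Definition evV (dx : R) (U : int -> {poly R}) (x : R) : R :=
  (U (cell_of dx x)).[x].

Definition trP (dx : R) (U : int -> {poly R}) (i : int) : R := (U i).[xg dx i].
Definition trM (dx : R) (U : int -> {poly R}) (i : int) : R := (U (i - 1)).[xg dx i].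
Definition jump (dx : R) (U : int -> {poly R}) (i : int) : R := trP dx U i - trM dx U i.
Definition avg (a b : R) : R := (a + b) / 2.

Definition L2sq (h : R -> R) : \bar R := (\int[leb]_x ((h x) ^+ 2)%:E)%E.

Definition inL2 (h : R -> R) : Prop :=
  measurable_fun setT h /\ (L2sq h < +oo)%E.

Definition VkL2 (dx : R) (k : nat) (U : int -> {poly R}) : Prop :=
  Vk k U /\ (L2sq (evV dx U) < +oo)%E.

Definition Hsemi (lam : R) (u : R -> R) : \bar R :=
  (\int[leb]_x \int[leb]_z
     (((u z - u x) ^+ 2) / powR `|z - x| (1 + lam))%:E)%E.

Definition intvL (lam c : R) (v u : R -> R) : R :=
  - (c / 2) * fine (\int[leb]_x \int[leb]_z
     (((v z - v x) * (u z - u x)) / powR `|z - x| (1 + lam))%:E)%E.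

Definition ext_cell (dx : R) (i : int) (p : {poly R}) (x : R) : R :=
  if x \in cellI dx i then p.[x] else 0.

(* U is C^1 on [0,T] with values in V^k cap L^2, with time derivative Ut
   (derivative and continuity understood in the L^2(R) norm, one-sided at
   the end points) *)
Definition C1VkL2 (dx : R) (k : nat) (T : R)
    (U Ut : R -> int -> {poly R}) : Prop :=
  (forall t, 0 <= t <= T -> VkL2 dx k (U t) /\ VkL2 dx k (Ut t)) /\
  (forall t, 0 <= t <= T -> forall e : R, 0 < e -> exists2 d : R, 0 < d &
     forall s, 0 <= s <= T -> 0 < `|s - t| < d ->
       (L2sq (fun x => (evV dx (U s) x - evV dx (U t) x) / (s - t)
                        - evV dx (Ut t) x)%R < e%:E)%E) /\
  (forall t, 0 <= t <= T -> forall e : R, 0 < e -> exists2 d : R, 0 < d &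
     forall s, 0 <= s <= T -> `|s - t| < d ->
       (L2sq (fun x => evV dx (Ut s) x - evV dx (Ut t) x)%R < e%:E)%E).

Definition int0 (h : R -> R) (u : R) : R :=
  if 0 <= u then (\int[leb]_(s in `[0, u]) h s)
  else - (\int[leb]_(s in `[u, 0]) h s).

Definition Fprim (f : R -> R) : R -> R := int0 f.
Definition gfun (a : R -> R) : R -> R := int0 (fun s => Num.sqrt (a s)).

(* difference quotients [G(u)]/[u], extended by continuity (value G'(u) = f(u)
   resp. sqrt(a(u)) when [u] = 0) *)
Definition ratioF (f : R -> R) (um up : R) : R :=
  if up == um then f um else (Fprim f up - Fprim f um) / (up - um).
Definition ratiog (a : R -> R) (um up : R) : R :=
  if up == um then Num.sqrt (a um) else (gfun a up - gfun a um) / (up - um).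

(* c11 = (1/[u]) ( [F(u)]/[u] - fhat(u^-,u^+) ); when [u] = 0 it equals 0 here
   (x / 0 = 0 in MathComp); c11 only ever appears multiplied by [u]. *)
Definition c11 (f : R -> R) (fhat : R -> R -> R) (um up : R) : R :=
  (ratioF f um up - fhat um up) / (up - um).

Definition hhat_u (dx : R) (f a : R -> R) (fhat : R -> R -> R)
    (c12 : R -> R -> R -> R -> R) (U Q : int -> {poly R}) (i : int) : R :=
  let um := trM dx U i in let up := trP dx U i in
  let qm := trM dx Q i in let qp := trP dx Q i in
  ratioF f um up - ratiog a um up * avg qm qp
  - c11 f fhat um up * (up - um) - c12 um qm up qp * (qp - qm).

Definition hhat_q (dx : R) (a : R -> R)
    (c12 : R -> R -> R -> R -> R) (U Q : int -> {poly R}) (i : int) : R :=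
  let um := trM dx U i in let up := trP dx U i in
  let qm := trM dx Q i in let qp := trP dx Q i in
  - avg (gfun a um) (gfun a up) + c12 um qm up qp * (up - um).

(* [w_i]' C [w_i] with C = ((c11, c12), (-c12, 0)) *)
Definition quadC (dx : R) (f : R -> R) (fhat : R -> R -> R)
    (c12 : R -> R -> R -> R -> R) (U Q : int -> {poly R}) (i : int) : R :=
  let um := trM dx U i in let up := trP dx U i in
  let qm := trM dx Q i in let qp := trP dx Q i in
  let ju := up - um in let jq := qp - qm in
  ju * (c11 f fhat um up * ju + c12 um qm up qp * jq)
  + jq * (- c12 um qm up qp * ju + 0 * jq).

Definition ThetaT (dx T : R) (f : R -> R) (fhat : R -> R -> R)
    (c12 : R -> R -> R -> R -> R) (U Q : R -> int -> {poly R}) : \bar R :=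
  (\int[leb]_(t in `[0%R, T])
     (\esum_(i in [set: int]) (quadC dx f fhat c12 (U t) (Q t) i)%:E))%E.

Definition LDG_solution (dx T lam c b : R) (k : nat) (f a : R -> R)
    (fhat : R -> R -> R) (c12 : R -> R -> R -> R -> R) (u0 : R -> R)
    (U Ut Q : R -> int -> {poly R}) : Prop :=
  (forall t, 0 < t < T -> forall (i : int) (v : {poly R}), (size v <= k.+1)%N ->
     (\int[leb]_(x in cellI dx i) ((Ut t i).[x] * v.[x]))
     - (\int[leb]_(x in cellI dx i)
          ((f (U t i).[x] - Num.sqrt (a (U t i).[x]) * (Q t i).[x])
           * (v^`()).[x]))
     + hhat_u dx f a fhat c12 (U t) (Q t) (i + 1) * v.[xg dx (i + 1)]
     - hhat_u dx f a fhat c12 (U t) (Q t) i * v.[xg dx i]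
     = b * intvL lam c (ext_cell dx i v) (evV dx (U t))) /\
  (forall t, 0 < t < T -> forall (i : int) (v : {poly R}), (size v <= k.+1)%N ->
     (\int[leb]_(x in cellI dx i) ((Q t i).[x] * v.[x]))
     - (\int[leb]_(x in cellI dx i) ((- gfun a (U t i).[x]) * (v^`()).[x]))
     + hhat_q dx a c12 (U t) (Q t) (i + 1) * v.[xg dx (i + 1)]
     - hhat_q dx a c12 (U t) (Q t) i * v.[xg dx i]
     = 0) /\
  (forall (i : int) (v : {poly R}), (size v <= k.+1)%N ->
     (\int[leb]_(x in cellI dx i) ((U 0 i).[x] * v.[x]))
     = (\int[leb]_(x in cellI dx i) (u0 x * v.[x]))).

End LDG.

(* Main.v *)
(** Testing the two LDG equations on the cell I_i with (u, q) and adding them, the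
    volume terms are the exact derivative of F(u) - g(u) q, so the cell identity
    telescopes: the interface contributions are [w_i]' C [w_i] = c11 [u_i]^2 >= 0,
    and the end terms are at most quadratic plus cubic in the traces.  By the
    inverse inequality |p|^2 + |p'|^2 <= C int p^2 on a cell (Gram matrix of the
    monomials), the squared traces of functions of V^k in L^2 are summable, so
    the end terms vanish at infinity.

    The same inequality dominates the Gagliardo form of the truncations of u to
    finitely many cells by an integrable function: inside a cell by
    |z - x|^(1 - lam), across cells by (u(x)^2 + u(z)^2) |z - x|^(-1 - lam), which
    is integrable since lam < 1.  Dominated convergence on the product measure
    then turns the sum of the cell terms of L into -(c/2) |u|^2.

    This gives the dissipation inequality at every time in ]0, T[.  Its left-hand
    side need not be known to be measurable in time: lower integrals are
    superadditive, which is the direction needed.  The right-hand side is the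
    continuous derivative of the energy, and the energy at time 0 is at most that
    of u_0 because u(0) is its L^2 projection. *)

Require Import Defs.
From HB Require Import structures.
From mathcomp Require Import all_boot all_order all_algebra.
From mathcomp Require Import all_classical all_reals all_analysis.
From mathcomp Require Import measurable_realfun zify ring lra.
Import Order.TTheory GRing.Theory Num.Theory.
Import numFieldNormedType.Exports.
Local Open Scope classical_set_scope.
Local Open Scope ring_scope.
Set Implicit Arguments.
Unset Strict Implicit.
Unset Printing Implicit Defensive.

(** * Inverse inequality on polynomials *)

(** The solution is not compactly supported, while the scheme holds only cell by cell; every global
    identity is therefore the limit of finite sums over the cells -N, ..., N-1. For the nonlocal
    term this exchanges a limit with a singular double integral. Integrability has to be settled
    before any algebra there: [intvL] takes [fine] of its double integral, which returns 0 on an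
    infinite value, so an unchecked sum of such terms would carry no information. The majorant uses
    the cell masses, the integrals of u^2 over single cells, rather than u pointwise. The masses are
    summable, and what multiplies them is an integral of the kernel alone, which by translation
    invariance has one bound for all cells. This is where the inverse inequality is indispensable:
    it turns both pointwise values and increments of u on a cell into the square root of its mass.
    The cubic part of the end terms comes from [c12], which is Lipschitz and vanishes at 0 but need
    not be bounded, so it contributes a factor linear in the traces. *)

Lemma continuous_integrable_cc (R : realType) (f : R -> R) (a b : R) : continuous f ->
  (@lebesgue_measure R).-integrable `[a, b] (EFin \o f).
Proof.
move=> cf; apply: continuous_compact_integrable; first exact: segment_compact.
exact: continuous_subspaceT.
Qed.

Lemma continuous_integrable_itv (R : realType) (f : R -> R) (a b : R) (c d : bool) :
  continuous f ->
  (@lebesgue_measure R).-integrable [set` Interval (BSide c a) (BSide d b)] (EFin \o f).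
Proof.
move=> /(@continuous_integrable_cc _ f a b) h; apply: integrableS h => //.
by move=> x /=; rewrite !in_itv; case: c; case: d => /= /andP[ax xb];
  rewrite ?(ltW ax) ?(ltW xb) ?ax ?xb.
Qed.

Lemma Rintegral_oo_FTC (R : realType) (F f : R -> R) (a b : R) : a < b ->
  (forall x : R, is_derive x (1 : R) F (f x)) -> continuous f ->
  \int[@lebesgue_measure R]_(x in `]a, b[) f x = F b - F a.
Proof.
move=> ab dF cf.
have dF' (x : R) : derivable F x 1 by case: (dF x).
have cF : continuous F.
  by move=> x; apply/differentiable_continuous/derivable1_diffP.
rewrite Rintegral_itv_obnd_cbnd; last exact: continuous_integrable_itv.
rewrite Rintegral_itv_bndo_bndc; last exact: continuous_integrable_itv.
rewrite /Rintegral (@continuous_FTC2 _ f F a b) //.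
- exact: continuous_subspaceT.
- split => [x _||]; first exact: dF'.
    exact/cvg_at_right_filter/cF.
  exact/cvg_at_left_filter/cF.
- by move=> x _; rewrite derive1E; apply: derive_val.
Qed.

Lemma is_derive_horner (R : realType) (p : {poly R}) (x : R) :
  is_derive x (1 : R) (horner p) p^`().[x].
Proof.
split; first exact: derivable_horner.
by rewrite derivE derive1E.
Qed.

(** The common core of the two Cauchy-Schwarz inequalities, for [polyint] and for [L2ip]. *)
Lemma quadratic_discriminant_le0 (R : realFieldType) (A B C : R) : 0 <= A -> 0 <= C ->
  (forall t, 0 <= A + 2 * t * B + t ^+ 2 * C) -> B ^+ 2 <= A * C.
Proof.
move=> A0 C0 h; have [C0'|C0'] := eqVneq C 0.
  have [->|B0] := eqVneq B 0; first by rewrite expr0n mulr_ge0.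
  (* With C = 0 the form is affine in t with slope 2 B; at this t its value is -1. *)
  have := h (- (A + 1) / (2 * B)); rewrite C0' mulr0 addr0.
  have -> : A + 2 * (- (A + 1) / (2 * B)) * B = -1 by field.
  lra.
have Cp : 0 < C by rewrite lt_neqAle eq_sym C0'.
(* The minimiser of the quadratic. *)
have := h (- B / C).
have -> : A + 2 * (- B / C) * B + (- B / C) ^+ 2 * C = (A * C - B ^+ 2) / C by field.
by rewrite pmulr_lge0 ?invr_gt0// subr_ge0.
Qed.

Section PolyInverse.
Variables (R : realType) (d : R).
Hypothesis d0 : 0 < d.

Definition polyint (p : {poly R}) : R :=
  \int[@lebesgue_measure R]_(x in `]0, d[) p.[x].

Let ip (p : {poly R}) a b :
  (@lebesgue_measure R).-integrable `]a, b[ (EFin \o (fun x => p.[x])).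
Proof. by apply: continuous_integrable_itv; exact: continuous_horner. Qed.

Lemma polyintD p q : polyint (p + q) = polyint p + polyint q.
Proof.
rewrite /polyint -RintegralD//; try exact: ip.
by apply: eq_Rintegral => x _; rewrite hornerD.
Qed.

Lemma polyintZ a p : polyint (a *: p) = a * polyint p.
Proof.
rewrite /polyint; under eq_Rintegral do rewrite hornerZ.
by rewrite RintegralZl//; exact: ip.
Qed.

Lemma polyint0 : polyint 0 = 0.
Proof. by rewrite -(scale0r 0) polyintZ mul0r. Qed.

Lemma polyint_sum n (F : 'I_n -> {poly R}) :
  polyint (\sum_i F i) = \sum_i polyint (F i).
Proof. by apply: big_morph; [exact: polyintD | exact: polyint0]. Qed.

Lemma polyint_sqr_ge0 p : 0 <= polyint (p ^+ 2).
Proof. by apply: Rintegral_ge0 => x _; rewrite horner_exp sqr_ge0. Qed.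

Definition poly_prim (p : {poly R}) : {poly R} :=
  \poly_(i < (size p).+1) (p`_i.-1 / i%:R).

Lemma deriv_poly_prim p : (poly_prim p)^`() = p.
Proof.
apply/polyP => i; rewrite coef_deriv coef_poly /= ltnS.
case: ltnP => [_|h]; last by rewrite mul0rn nth_default.
by rewrite -[LHS]mulr_natr divfK// pnatr_eq0.
Qed.

Lemma Rintegral_poly p a b : a < b ->
  \int[@lebesgue_measure R]_(x in `]a, b[) p.[x]
  = (poly_prim p).[b] - (poly_prim p).[a].
Proof.
move=> ab; apply: (@Rintegral_oo_FTC _ (horner (poly_prim p))) => //.
  by move=> x; rewrite -{2}(deriv_poly_prim p); exact: is_derive_horner.
exact: continuous_horner.
Qed.

(** Transport to the reference cell ]0, d[, which makes the constants of the inverse inequality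
    independent of the position of the cell. *)
Lemma Rintegral_poly_shift p x0 :
  \int[@lebesgue_measure R]_(x in `]x0, x0 + d[) p.[x]
  = polyint (p \Po ('X + x0%:P)).
Proof.
rewrite Rintegral_poly ?ltrDl//.
transitivity ((poly_prim p \Po ('X + x0%:P)).[d] - (poly_prim p \Po ('X + x0%:P)).[0]).
  by rewrite !horner_comp !hornerE ?(addrC d) ?add0r.
symmetry; apply: (@Rintegral_oo_FTC _ (horner (poly_prim p \Po ('X + x0%:P)))) => //.
- move=> x; rewrite -{2}(deriv_poly_prim p).
  have -> : ((poly_prim p)^`() \Po ('X + x0%:P)).[x]
     = ((poly_prim p) \Po ('X + x0%:P))^`().[x].
    by rewrite deriv_comp derivD derivX derivC addr0 mulr1.
  exact: is_derive_horner.
- exact: continuous_horner.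
Qed.

(* A nondecreasing primitive with equal end values is constant on ]0, d[, so it
   has too many roots. *)
Lemma polyint_sqr_eq0 p : polyint (p ^+ 2) = 0 -> p = 0.
Proof.
rewrite /polyint Rintegral_poly// => /eqP; rewrite subr_eq0 => /eqP h.
set P := poly_prim _ in h.
have mono x y : 0 <= x -> x <= y -> y <= d -> P.[x] <= P.[y].
  apply: (@ger0_derive1_ndecr _ (horner P) 0 d).
  - by move=> z _; exact: derivable_horner.
  - by move=> z _; rewrite -derivE deriv_poly_prim horner_exp sqr_ge0.
  - by apply: continuous_subspaceT; exact: continuous_horner.
have c x : 0 <= x <= d -> P.[x] = P.[0].
  move=> /andP[x0 xd]; apply/eqP; rewrite eq_le; apply/andP; split.
    by rewrite -h; exact: mono.
  exact: mono.
have PC : P - P.[0]%:P = 0.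
  (* As many distinct points of ]0, d[ as the size of the polynomial, one more than the number of
     roots it could have if it were nonzero. *)
  pose s := [seq d / (i.+2)%:R | i <- iota 0 (size (P - P.[0]%:P))].
  apply: (@roots_geq_poly_eq0 _ _ s).
  - apply/allP => _ /mapP[i _ ->]; rewrite rootE !hornerE c ?subrr//.
    by rewrite divr_ge0 ?(ltW d0)//= ler_pdivrMr ?ltr0n// ler_peMr ?(ltW d0)// ler1n.
  - rewrite map_inj_uniq ?iota_uniq// => i j /(mulfI (lt0r_neq0 d0)) /invr_inj.
    by move/eqP; rewrite eqr_nat => /eqP[].
  - by rewrite size_map size_iota.
have : (P - P.[0]%:P)^`() = p ^+ 2 by rewrite derivB derivC subr0 deriv_poly_prim.
by rewrite PC deriv0 => /esym/eqP; rewrite expf_eq0 /= => /eqP.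
Qed.

Lemma polyint_CS p q : (polyint (p * q)) ^+ 2 <= polyint (p ^+ 2) * polyint (q ^+ 2).
Proof.
apply: quadratic_discriminant_le0; rewrite ?polyint_sqr_ge0// => t.
have := polyint_sqr_ge0 (p + t *: q).
have -> : (p + t *: q) ^+ 2 = p ^+ 2 + (2 * t) *: (p * q) + t ^+ 2 *: q ^+ 2.
  by rewrite -!mul_polyC !polyCM; ring.
by rewrite !polyintD !polyintZ.
Qed.

Definition gram n : 'M[R]_n := \matrix_(i, j) polyint ('X^(i + j)).

Lemma gramE n (p : {poly R}) j : (size p <= n)%N ->
  (poly_rV p *m gram n) 0 j = polyint (p * 'X^j).
Proof.
move=> sp; rewrite mxE.
have -> : p * 'X^j = \sum_(i < n) p`_i *: 'X^(i + j).
  rewrite {1}(_ : p = \sum_(i < n) p`_i *: 'X^i).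
    by rewrite mulr_suml; apply: eq_bigr => i _; rewrite -scalerAl exprD.
  rewrite -{1}(coefK p) poly_def (big_ord_widen _ (fun i => p`_i *: 'X^i) sp).
  rewrite big_mkcond /=; apply: eq_bigr => i _.
  by case: ltnP => // h; rewrite nth_default// scale0r.
rewrite polyint_sum; apply: eq_bigr => i _.
by rewrite polyintZ !mxE.
Qed.

(** A row vector killed by the Gram matrix is the coefficient vector of a polynomial orthogonal to
    all monomials, hence to itself, hence zero. *)
Lemma gram_unit n : gram n \in unitmx.
Proof.
rewrite -row_free_unit -kermx_eq0; apply/eqP/eqP/rowV0P => v /sub_kermxP vG.
have sv : (size (rVpoly v) <= n)%N by exact: size_poly.
suff : rVpoly v = 0 by move=> h; rewrite -(rVpolyK v) h linear0.
set p := rVpoly v in sv *; apply: polyint_sqr_eq0.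
have h (j : 'I_n) : polyint (p * 'X^j) = 0.
  by have := gramE j sv; rewrite rVpolyK vG mxE => <-.
have -> : p ^+ 2 = \sum_(i < n) p`_i *: (p * 'X^i).
  rewrite expr2 {2}(_ : p = \sum_(i < n) p`_i *: 'X^i).
    by rewrite mulr_sumr; apply: eq_bigr => i _; rewrite scalerAr.
  rewrite -{1}(coefK p) poly_def (big_ord_widen _ (fun i => p`_i *: 'X^i) sv).
  rewrite big_mkcond /=; apply: eq_bigr => i _.
  by case: ltnP => // hi; rewrite nth_default// scale0r.
rewrite polyint_sum big1// => i _; by rewrite polyintZ h mulr0.
Qed.

(** Inverting the Gram matrix writes each coefficient as a fixed linear combination of the moments
    of p against the monomials, and Cauchy-Schwarz bounds each moment. Summing over all entries of
    the inverse makes [B] uniform in the index of the coefficient. *)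
Lemma coef_le_polyint n : exists2 B, 0 <= B & forall p : {poly R}, (size p <= n)%N ->
  forall i, `|p`_i| <= B * Num.sqrt (polyint (p ^+ 2)).
Proof.
pose B := \sum_(i < n) \sum_(j < n)
   Num.sqrt (polyint ('X^j ^+ 2)) * `|invmx (gram n) j i|.
have T0 (i j : 'I_n) : 0 <= Num.sqrt (polyint ('X^j ^+ 2)) * `|invmx (gram n) j i|.
  by rewrite mulr_ge0 ?sqrtr_ge0.
exists B; first by do 2 apply: sumr_ge0 => ? _; exact: T0.
move=> p sp i.
have [hi|hi] := ltnP i n; last first.
  rewrite nth_default ?(leq_trans sp)// normr0 mulr_ge0 ?sqrtr_ge0//.
  by do 2 apply: sumr_ge0 => ? _; exact: T0.
pose i' := Ordinal hi.
have -> : p`_i = \sum_(j < n) polyint (p * 'X^j) * invmx (gram n) j i'.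
  have : poly_rV p = (poly_rV p *m gram n) *m invmx (gram n) :> 'rV_n.
    by rewrite mulmxK// gram_unit.
  move/rowP/(_ i'); rewrite !mxE => ->; apply: eq_bigr => j _.
  by rewrite gramE.
apply: (le_trans (ler_norm_sum _ _ _)).
apply: (@le_trans _ _ (\sum_(j < n)
   (Num.sqrt (polyint ('X^j ^+ 2)) * `|invmx (gram n) j i'|) * Num.sqrt (polyint (p ^+ 2)))).
  apply: ler_sum => j _; rewrite normrM mulrAC ler_wpM2r//.
  rewrite -sqrtrM ?polyint_sqr_ge0// -sqrtr_sqr ler_wsqrtr//.
  by rewrite mulrC polyint_CS.
rewrite -mulr_suml ler_wpM2r ?sqrtr_ge0// // /B [leRHS](bigD1 i')//= lerDl.
by apply: sumr_ge0 => ? _; apply: sumr_ge0 => ? _; exact: T0.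
Qed.

Lemma horner_le_coef n (p : {poly R}) B x : (size p <= n)%N ->
  (forall i, `|p`_i| <= B) -> 0 <= x <= d ->
  `|p.[x]| <= B * \sum_(i < n) d ^+ i.
Proof.
move=> sp hB /andP[x0 xd]; rewrite (horner_coef_wide x sp) mulr_sumr.
apply: (le_trans (ler_norm_sum _ _ _)); apply: ler_sum => i _.
rewrite normrM ler_pM// normrX (ger0_norm x0).
by rewrite lerXn2r// nnegrE// ltW.
Qed.

Lemma poly_inverse_ineq0 n : exists2 C, 0 <= C & forall p : {poly R}, (size p <= n)%N ->
  forall x y, 0 <= x <= d -> 0 <= y <= d ->
  `|p.[x]| <= C * Num.sqrt (polyint (p ^+ 2)) /\
  `|p.[y] - p.[x]| <= C * Num.sqrt (polyint (p ^+ 2)) * `|y - x|.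
Proof.
have [B B0 hB] := coef_le_polyint n.
pose S := \sum_(i < n) d ^+ i.
have S0 : 0 <= S by apply: sumr_ge0 => i _; rewrite exprn_ge0// ltW.
(* [B] bounds the coefficients, [S] the sum of the powers of x on [0, d], and n+1 the integer
   factors created by differentiation; the mean value theorem then turns the bound on the derivative
   into the Lipschitz bound. *)
exists (B * S * n.+1%:R); first by rewrite !mulr_ge0.
move=> p sp; set N := Num.sqrt _.
have N0 : 0 <= N by rewrite sqrtr_ge0.
have h1 x : 0 <= x <= d -> `|p.[x]| <= B * S * n.+1%:R * N.
  move=> hx; apply: (le_trans (horner_le_coef sp (hB _ sp) hx)).
  rewrite -/S -/N mulrAC -[leRHS]mulrAC ler_peMr ?ler1n//.
  by rewrite !mulr_ge0.
have h2 x : 0 <= x <= d -> `|p^`().[x]| <= B * S * n.+1%:R * N.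
  move=> hx; have sp' : (size p^`() <= n)%N.
    have [->|p0] := eqVneq p 0; first by rewrite deriv0 size_poly0.
    by rewrite (leq_trans _ sp)// ltnW// lt_size_deriv.
  have -> : B * S * n.+1%:R * N = (B * N * n.+1%:R) * S by ring.
  apply: (horner_le_coef sp' _ hx) => i.
  rewrite coef_deriv.
  have [hi|hi] := ltnP i n; last first.
    rewrite nth_default ?mul0rn ?normr0 ?mulr_ge0//.
    by rewrite (leq_trans sp)// (leq_trans hi).
  rewrite -[_ *+ i.+1]mulr_natr normrM ler_pM// ?hB//.
  by rewrite normr_nat ler_nat ltnS ltnW.
have h3 x y : x < y -> 0 <= x <= d -> 0 <= y <= d ->
   `|p.[y] - p.[x]| <= B * S * n.+1%:R * N * `|y - x|.
  move=> xy /andP[x0 xd] /andP[y0 yd].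
  have [|c + ->] := @MVT _ (horner p) (horner p^`()) _ _ xy (fun z _ => is_derive_horner p z).
    by apply: continuous_subspaceT; exact: continuous_horner.
  rewrite in_itv /= => /andP[xc cy]; rewrite normrM ler_wpM2r// h2//.
  by rewrite (le_trans x0 (ltW xc)) (le_trans (ltW cy)).
move=> x y hx hy; split; first exact: h1.
case: (ltgtP x y) => [xy|yx|->]; first exact: h3.
  by rewrite distrC (distrC y) h3.
by rewrite !subrr normr0 mulr0.
Qed.

(** The points range over the closed cell, so that the traces at both ends are included. *)
Lemma poly_inverse_ineq n : exists2 C, 0 <= C & forall (p : {poly R}) x0, (size p <= n)%N ->
  let M := \int[@lebesgue_measure R]_(x in `]x0, x0 + d[) (p.[x]) ^+ 2 in
  forall x y, x0 <= x <= x0 + d -> x0 <= y <= x0 + d ->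
  p.[x] ^+ 2 <= C * M /\ (p.[y] - p.[x]) ^+ 2 <= C * M * (y - x) ^+ 2.
Proof.
have [C C0 hC] := poly_inverse_ineq0 n.
exists (C ^+ 2); first exact: sqr_ge0.
move=> p x0 sp M x y hx hy.
pose q := p \Po ('X + x0%:P).
have sq : (size q <= n)%N.
  by rewrite /q size_comp_poly2// size_XaddC.
have ME : M = polyint (q ^+ 2).
  rewrite /q /M expr2 -comp_polyM -expr2 -Rintegral_poly_shift.
  by apply: eq_Rintegral => z _; rewrite horner_exp.
have qE z : p.[z] = q.[z - x0] by rewrite /q horner_comp !hornerE subrK.
have [] := hC q sq (x - x0) (y - x0).
- by rewrite subr_ge0 lerBlDl.
- by rewrite subr_ge0 lerBlDl.
rewrite -!qE -ME.
have M0 : 0 <= M by rewrite ME polyint_sqr_ge0.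
have -> : y - x0 - (x - x0) = y - x by ring.
move=> h1 h2; split.
  rewrite -real_normK ?num_real// -[M]sqr_sqrtr// -exprMn.
  by rewrite lerXn2r ?nnegrE// mulr_ge0 ?sqrtr_ge0.
rewrite -real_normK ?num_real// -[M]sqr_sqrtr// -[(y - x) ^+ 2]real_normK ?num_real//.
by rewrite -!exprMn lerXn2r ?nnegrE// !mulr_ge0 ?sqrtr_ge0.
Qed.

End PolyInverse.

(** * Sums over cells *)

(** Measurability of functions given cell by cell: on the line for [evV], on the plane for [kappa]
    and [dominant]. *)
Lemma measurable_fun_countable_partition d1 d2 (T1 : measurableType d1) (T2 : measurableType d2)
    (I : countType) (c : T1 -> I) (G : I -> T1 -> T2) :
  (forall i, measurable (c @^-1` [set i])) ->
  (forall i, measurable_fun setT (G i)) ->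
  measurable_fun setT (fun x => G (c x) x).
Proof.
move=> mc mG _ Y mY; rewrite setTI.
rewrite (_ : _ @^-1` Y = \bigcup_i (c @^-1` [set i] `&` G i @^-1` Y)).
  apply: countable_bigcupT_measurable; first exact: countableP.
  by move=> i; apply: measurableI => //; rewrite -[X in measurable X]setTI; exact: mG.
apply/seteqP; split => x /=; first by move=> Yx; exists (c x).
by move=> [i _ [/= -> ]].
Qed.

Section Cells.
Variables (R : realType) (dx : R).
Hypothesis dx0 : 0 < dx.
Local Notation leb := (@lebesgue_measure R).

(** The half-open cells are the fibres of [cell_of] and tile the line exactly; they differ from the
    open cells of the scheme by one point. *)
Definition hcell (i : int) : set R := `[xg dx i, xg dx (i + 1)[%classic.

Lemma xgS i : xg dx (i + 1) = xg dx i + dx.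
Proof. by rewrite /xg intrD mulrDl mul1r. Qed.

Lemma hcellP i x : hcell i x <-> cell_of dx x = i.
Proof.
rewrite /hcell /cell_of /xg /=; split.
  rewrite in_itv /= => /andP[h1 h2]; apply: floor_def.
  by rewrite ler_pdivlMr// ltr_pdivrMr// h1.
move=> <-; rewrite in_itv /=; have /andP[h1 h2] := floor_itv (x / dx).
by rewrite -ler_pdivlMr// -ltr_pdivrMr// h1.
Qed.

Lemma cellI_hcell i : cellI dx i `<=` hcell i.
Proof. by move=> x; rewrite /cellI /hcell /= !in_itv /= => /andP[/ltW -> ->]. Qed.

Lemma cellI_cell_of i x : cellI dx i x -> cell_of dx x = i.
Proof. by move=> /cellI_hcell /hcellP. Qed.

Lemma evV_cellI U i x : cellI dx i x -> evV dx U x = (U i).[x].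
Proof. by rewrite /evV => /cellI_cell_of ->. Qed.

Lemma measurable_cell_of_fiber i : measurable (cell_of dx @^-1` [set i]).
Proof.
rewrite (_ : _ @^-1` _ = hcell i); first exact: measurable_itv.
by apply/seteqP; split => x /= /hcellP.
Qed.

Lemma measurable_evV U : measurable_fun setT (evV dx U).
Proof.
apply: (@measurable_fun_countable_partition _ _ _ _ _ (cell_of dx) (fun i => horner (U i))).
  exact: measurable_cell_of_fiber.
by move=> i; exact: measurable_poly.
Qed.

Definition cell_window N : set R := `[xg dx (- N%:Z), xg dx N%:Z[%classic.

(** Since [Negz n] is -(n+1), the indices are -N, ..., N-1, those of the cells that make up
    [cell_window N]. *)
Definition cell_sum (V : nmodType) (F : int -> V) N : V :=
  \sum_(n < N) (F n%:Z + F (Negz n)).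

Lemma xg_le i j : (xg dx i <= xg dx j) = (i <= j).
Proof. by rewrite /xg ler_pM2r// ler_int. Qed.

Lemma cell_windowS N :
  cell_window N.+1 = (cell_window N `|` hcell N%:Z) `|` hcell (Negz N).
Proof.
have e1 : xg dx (- N%:Z) = xg dx (Negz N + 1) by rewrite NegzE -addn1 PoszD opprD subrK.
have e2 : xg dx (N.+1%:Z) = xg dx (N%:Z + 1) by rewrite -addn1 PoszD.
have l0 : xg dx (Negz N) <= xg dx (Negz N + 1) by rewrite xg_le lerDl.
have l1 : xg dx (Negz N + 1) <= xg dx N by rewrite -e1 xg_le; lia.
have l2 : xg dx N <= xg dx (N%:Z + 1) by rewrite xg_le lerDl.
rewrite /cell_window /hcell -NegzE e1 e2; apply/seteqP; split => x /=; rewrite !in_itv /=.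
  move=> /andP[h1 h2]; have [h3|h3] := ltP x (xg dx (Negz N + 1)).
    by right; rewrite h1.
  by left; have [h4|h4] := ltP x (xg dx N); [left|right; rewrite h2].
case=> [[|]|] /andP[h1 h2].
- by rewrite (le_trans l0 h1) (lt_le_trans h2 l2).
- by rewrite h2 (le_trans (le_trans l0 l1) h1).
- by rewrite h1 (lt_le_trans h2) // (le_trans l1 l2).
Qed.

Lemma integral_hcell (h : R -> \bar R) i : measurable_fun setT h ->
  (\int[leb]_(x in hcell i) h x = \int[leb]_(x in cellI dx i) h x)%E.
Proof.
move=> mh; apply: integral_itv_bndoo.
exact: measurable_funS mh.
Qed.

Lemma integral_cell_window (h : R -> \bar R) N : measurable_fun setT h ->
  (\int[leb]_(x in cell_window N) h x =
    cell_sum (fun i => \int[leb]_(x in cellI dx i) h x) N)%E.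
Proof.
move=> mh; elim: N => [|N IH].
  rewrite /cell_sum big_ord0 (_ : cell_window 0 = set0) ?integral_set0//.
  by rewrite /cell_window oppr0 set_itv_ge// bnd_simp ltxx.
rewrite cell_windowS integral_setU; first last.
- apply/disj_setPS => x /= [[]]; rewrite /cell_window /hcell /= !in_itv /=.
    move=> /andP[h1 _] /andP[_]; rewrite ltNge.
    by rewrite NegzE -addn1 PoszD opprD subrK h1.
  move=> /andP[h1 _] /andP[_]; rewrite ltNge.
  by rewrite (le_trans _ h1)// xg_le; lia.
- exact: measurable_funS mh.
- exact: measurable_itv.
- by apply: measurableU; exact: measurable_itv.
rewrite integral_setU; first last.
- apply/disj_setPS => x /= []; rewrite /cell_window /hcell /= !in_itv /=.
  by move=> /andP[_ h1] /andP[]; rewrite leNgt h1.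
- exact: measurable_funS mh.
- exact: measurable_itv.
- exact: measurable_itv.
by rewrite IH /cell_sum big_ord_recr /= !integral_hcell//; exact/esym/addeA.
Qed.

Lemma nondecreasing_cell_window : {homo cell_window : n m / (n <= m)%N >-> (n <= m)%O}.
Proof.
move=> n m nm; apply/subsetPset => x; rewrite /cell_window /= !in_itv /= => /andP[h1 h2].
rewrite (le_trans _ h1) ?(lt_le_trans h2)// xg_le; lia.
Qed.

Lemma in_cell_window x : exists N0, forall N, (N0 <= N)%N -> cell_window N x.
Proof.
exists (Num.trunc (`|x| / dx)).+1 => N hN.
have h : `|x| < N%:R * dx.
  rewrite -ltr_pdivrMr// (lt_le_trans (truncnS_gt _))// ler_nat //.
rewrite /cell_window /xg /= in_itv /= mulrNz mulNr.
by move: h; rewrite ltr_norml => /andP[/ltW -> ->].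
Qed.

Lemma bigcup_cell_window : \bigcup_N cell_window N = setT.
Proof.
apply/seteqP; split => // x _.
by have [N /(_ N (leqnn _)) hN] := in_cell_window x; exists N.
Qed.

(** Monotone convergence along the windows; nothing is assumed integrable, so this can be used to
    prove finiteness. *)
Lemma ge0_integral_le_cell_sum (h : R -> \bar R) (B : \bar R) :
  measurable_fun setT h -> (forall x, 0 <= h x)%E ->
  (forall N, cell_sum (fun i => \int[leb]_(x in cellI dx i) h x)%E N <= B)%E ->
  (\int[leb]_x h x <= B)%E.
Proof.
move=> mh h0 hB; rewrite -bigcup_cell_window.
have c : (\int[leb]_(x in cell_window N) h x @[N --> \oo] -->
    \int[leb]_(x in \bigcup_N cell_window N) h x)%E.
  apply: ge0_nondecreasing_set_cvg_integral => //.
  - exact: nondecreasing_cell_window.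
  - by move=> i; exact: measurable_itv.
  - by move=> i; exact: measurable_funS mh.
rewrite -(cvg_lim _ c)//; apply: lime_le; first by apply/cvg_ex; eexists; exact: c.
by apply: nearW => N; rewrite integral_cell_window.
Qed.

(** Dominated convergence for the restrictions of h to the windows, with |h| as majorant. *)
Lemma cvg_cell_sum_Rintegral (h : R -> R) :
  leb.-integrable setT (EFin \o h) ->
  cell_sum (fun i => \int[leb]_(x in cellI dx i) h x) N @[N --> \oo]
    --> \int[leb]_x h x.
Proof.
move=> ih.
have mh : measurable_fun setT h by apply/measurable_EFinP; case/integrableP: ih.
have mEh : measurable_fun setT (EFin \o h) by case/integrableP: ih.
have cellE i : (\int[leb]_(x in cellI dx i) (h x)%:E)%E \is a fin_num.
  apply: integrable_fin_num; first exact: measurable_itv.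
  by apply: integrableS ih => //; exact: measurable_itv.
have sumE N : cell_sum (fun i => \int[leb]_(x in cellI dx i) h x) N =
    fine (\int[leb]_(x in cell_window N) (h x)%:E)%E.
  rewrite integral_cell_window// /cell_sum.
  have fs n : (\sum_(i < n) ((\int[leb]_(x in cellI dx i) (h x)%:E) +
      (\int[leb]_(x in cellI dx (Negz i)) (h x)%:E)))%E \is a fin_num.
    elim: n => [|n IH]; first by rewrite big_ord0.
    rewrite big_ord_recr /= fin_numD IH /=.
    by rewrite fin_numD (cellE (Posz n)) (cellE (Negz n)).
  elim: N => [|N IH]; first by rewrite !big_ord0.
  rewrite !big_ord_recr /= IH -fineD ?cellE// -fineD ?fs//.
  by rewrite fin_numD !cellE.
rewrite (_ : (fun N => _) = fine \o (fun N => \int[leb]_(x in cell_window N) (h x)%:E)%E); last first.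
  by apply/funext => N; rewrite sumE.
apply: fine_cvg; rewrite fineK; last exact: integrable_fin_num.
have [] := @dominated_convergence _ _ _ leb setT measurableT
   (fun N => (EFin \o h) \_ (cell_window N)) (EFin \o h) (abse \o (EFin \o h)).
- move=> N; apply/(measurable_restrictT _ _).1; first exact: measurable_itv.
  exact: measurable_funS mEh.
- exact: mEh.
- apply: aeW => x _; have [N0 hN] := in_cell_window x.
  apply: cvg_near_cst; near=> N; rewrite patchE mem_set//; apply: hN.
  by near: N; exists N0.
- exact: integrable_abse.
- apply: aeW => x N _; rewrite patchE; case: ifP => //= _.
  by rewrite normr0 lee_fin.
move=> _ _; apply: cvg_trans; apply: near_eq_cvg; apply: nearW => N /=.
by rewrite [RHS]integral_mkcond.
Unshelve. all: by end_near.
Qed.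

End Cells.

(** * Differentiation of the energy in time *)

Section L2Space.
Variable R : realType.
Local Notation leb := (@lebesgue_measure R).
Implicit Types h g : R -> R.

Definition L2ip h g : R := \int[leb]_x (h x * g x).
Definition L2norm h : R := Num.sqrt (L2ip h h).

Lemma integrable_mul_L2 h g : inL2 h -> inL2 g ->
  leb.-integrable setT (EFin \o (fun x => h x * g x)).
Proof.
move=> [mh lh] [mg lg].
have msq (k : R -> R) : measurable_fun setT k ->
    measurable_fun setT (fun x => ((k x) ^+ 2)%:E).
  by move=> mk; apply/measurable_EFinP; exact: measurable_funX.
have isq (k : R -> R) : measurable_fun setT k -> (L2sq k < +oo)%E ->
    leb.-integrable setT (fun x => ((k x) ^+ 2)%:E).
  move=> mk lk; apply/integrableP; split; first exact: msq.
  apply: le_lt_trans lk; apply: ge0_le_integral => //.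
  - by apply: measurableT_comp => //; exact: msq.
  - exact: msq.
  - by move=> x _ /=; rewrite ger0_norm ?sqr_ge0.
have i : leb.-integrable setT (fun x => ((h x) ^+ 2)%:E + ((g x) ^+ 2)%:E)%E.
  by apply: integrableD => //; exact: isq.
apply: le_integrable i => //.
  by apply/measurable_EFinP; exact: measurable_funM.
move=> x _ /=; rewrite lee_fin [leRHS]ger0_norm ?addr_ge0 ?sqr_ge0//.
by rewrite ler_norml; apply/andP; split; nra.
Qed.

Lemma L2sqE h : inL2 h -> L2sq h = (L2ip h h)%:E.
Proof.
move=> hh; rewrite /L2ip /Rintegral fineK; last first.
  by apply: integrable_fin_num => //; exact: integrable_mul_L2.
by apply: eq_integral => x _; rewrite expr2.
Qed.

Lemma inL2D h g : inL2 h -> inL2 g -> inL2 (fun x => h x + g x).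
Proof.
move=> hh hg; have [mh lh] := hh; have [mg lg] := hg; split.
  exact: measurable_funD.
rewrite /L2sq.
have -> : (\int[leb]_x ((h x + g x) ^+ 2)%:E =
  \int[leb]_x (((h x * h x)%:E + (g x * g x)%:E) + ((h x * g x)%:E + (h x * g x)%:E)))%E.
  by apply: eq_integral => x _; rewrite -!EFinD; congr EFin; ring.
have i1 := integrable_mul_L2 hh hh; have i2 := integrable_mul_L2 hg hg.
have i3 := integrable_mul_L2 hh hg.
have i := integrableD measurableT (integrableD measurableT i1 i2) (integrableD measurableT i3 i3).
have := integrable_fin_num measurableT i.
by move=> /(@fin_numPlt _ _) /andP[].
Qed.

Lemma inL2Z a h : inL2 h -> inL2 (fun x => a * h x).
Proof.
move=> hh; have [mh lh] := hh; split; first exact: measurable_funM.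
rewrite /L2sq.
have -> : (\int[leb]_x ((a * h x) ^+ 2)%:E = \int[leb]_x ((a ^+ 2)%:E * (h x * h x)%:E))%E.
  by apply: eq_integral => x _; rewrite -!EFinM; congr EFin; ring.
have i := integrableZl measurableT (a ^+ 2) (integrable_mul_L2 hh hh).
have := integrable_fin_num measurableT i.
by move=> /(@fin_numPlt _ _) /andP[].
Qed.

Lemma inL2B h g : inL2 h -> inL2 g -> inL2 (fun x => h x - g x).
Proof.
move=> hh hg; have := inL2D hh (inL2Z (-1) hg).
by congr inL2; apply/funext => x; rewrite mulN1r.
Qed.

Lemma L2ipC h g : L2ip h g = L2ip g h.
Proof. by apply: eq_Rintegral => x _; rewrite mulrC. Qed.

Lemma L2ipDl h1 h2 g : inL2 h1 -> inL2 h2 -> inL2 g ->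
  L2ip (fun x => h1 x + h2 x) g = L2ip h1 g + L2ip h2 g.
Proof.
move=> i1 i2 i3; rewrite /L2ip -RintegralD//; try exact: integrable_mul_L2.
by apply: eq_Rintegral => x _; rewrite mulrDl.
Qed.

Lemma L2ipZl a h g : inL2 h -> inL2 g -> L2ip (fun x => a * h x) g = a * L2ip h g.
Proof.
move=> i1 i2; rewrite /L2ip -RintegralZl//; last exact: integrable_mul_L2.
by apply: eq_Rintegral => x _; rewrite mulrA.
Qed.

Lemma L2ip_ge0 h : 0 <= L2ip h h.
Proof. by apply: Rintegral_ge0 => x _; rewrite -expr2 sqr_ge0. Qed.

(** Serves three purposes: Cauchy-Schwarz (t free), the triangle inequality (t = 1) and the
    difference quotient of the energy (t a time increment). *)
Lemma L2ip_expand t h g : inL2 h -> inL2 g ->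
  L2ip (fun x => h x + t * g x) (fun x => h x + t * g x) =
  L2ip h h + 2 * t * L2ip h g + t ^+ 2 * L2ip g g.
Proof.
move=> ih ig; have itg := inL2Z t ig; have isum := inL2D ih itg.
rewrite L2ipDl// (L2ipC h) (L2ipC (fun x => t * g x)) !L2ipDl// !L2ipZl//.
by rewrite (L2ipC _ (fun x => t * g x)) (L2ipC g (fun x => t * g x)) !L2ipZl// (L2ipC g h); ring.
Qed.

Lemma L2norm_ge0 h : 0 <= L2norm h. Proof. exact: sqrtr_ge0. Qed.

Lemma L2norm_sqr h : L2norm h ^+ 2 = L2ip h h.
Proof. by rewrite sqr_sqrtr// L2ip_ge0. Qed.

Lemma L2_CauchySchwarz h g : inL2 h -> inL2 g -> `|L2ip h g| <= L2norm h * L2norm g.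
Proof.
move=> ih ig; rewrite -(ler_pXn2r (_ : 0 < 2)%N)// ?nnegrE ?mulr_ge0 ?L2norm_ge0//.
rewrite real_normK ?num_real// exprMn !L2norm_sqr.
apply: quadratic_discriminant_le0; rewrite ?L2ip_ge0// => t.
by rewrite -L2ip_expand// L2ip_ge0.
Qed.

Lemma L2normD h g : inL2 h -> inL2 g ->
  L2norm (fun x => h x + g x) <= L2norm h + L2norm g.
Proof.
move=> ih ig; rewrite -(ler_pXn2r (_ : 0 < 2)%N)// ?nnegrE ?addr_ge0 ?L2norm_ge0//.
rewrite sqrrD !L2norm_sqr.
have -> : (fun x => h x + g x) = (fun x => h x + 1 * g x).
  by apply/funext => x; rewrite mul1r.
rewrite L2ip_expand// expr1n mul1r mulr1 mulr2n.
have := le_trans (ler_norm _) (L2_CauchySchwarz ih ig); lra.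
Qed.

Lemma L2normZ a h : inL2 h -> L2norm (fun x => a * h x) = `|a| * L2norm h.
Proof.
move=> ih; rewrite /L2norm L2ipZl//; last exact: inL2Z.
rewrite L2ipC L2ipZl// mulrA -expr2 sqrtrM ?sqr_ge0// sqrtr_sqr//.
Qed.

Lemma L2sq_lt_norm h e : inL2 h -> 0 < e -> (L2sq h < (e ^+ 2)%:E)%E -> L2norm h < e.
Proof.
move=> ih e0; rewrite L2sqE// lte_fin -L2norm_sqr ltr_pXn2r// nnegrE ?L2norm_ge0//.
exact: ltW.
Qed.

End L2Space.

Section EnergyDerivative.
Variables (R : realType) (T : R) (u v : R -> R -> R).
Hypothesis T0 : 0 < T.
Hypothesis uL2 : forall t, 0 <= t <= T -> inL2 (u t).
Hypothesis vL2 : forall t, 0 <= t <= T -> inL2 (v t).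
Hypothesis dquot : forall t, 0 <= t <= T -> forall e : R, 0 < e -> exists2 d : R, 0 < d &
     forall s, 0 <= s <= T -> 0 < `|s - t| < d ->
       (L2sq (fun x => (u s x - u t x) / (s - t) - v t x)%R < e%:E)%E.
Hypothesis vcont : forall t, 0 <= t <= T -> forall e : R, 0 < e -> exists2 d : R, 0 < d &
     forall s, 0 <= s <= T -> `|s - t| < d -> (L2sq (fun x => v s x - v t x)%R < e%:E)%E.

Let E t := L2ip (u t) (u t).
Let L t := 2 * L2ip (v t) (u t).

Let w s t := fun x => (u s x - u t x) / (s - t).

Let wE s t : w s t = fun x => (s - t)^-1 * (u s x - u t x).
Proof. by apply/funext => x; rewrite mulrC. Qed.

Let wL2 s t : 0 <= s <= T -> 0 <= t <= T -> inL2 (w s t).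
Proof. by move=> hs ht; rewrite wE; apply: inL2Z; apply: inL2B; exact: uL2. Qed.

Let dquot_norm t : 0 <= t <= T -> forall e, 0 < e -> exists2 d : R, 0 < d &
  forall s, 0 <= s <= T -> 0 < `|s - t| < d ->
    L2norm (fun x => w s t x - v t x) < e.
Proof.
move=> ht e e0; have [d d0 hd] := dquot ht (exprn_gt0 2 e0).
exists d => // s hs hst; apply: L2sq_lt_norm => //; last exact: hd.
by apply: inL2B; [exact: wL2|exact: vL2].
Qed.

Let usE s t : 0 < `|s - t| -> u s = fun x => u t x + (s - t) * w s t x.
Proof.
rewrite normr_gt0 => st; apply/funext => x.
by rewrite /w mulrC divfK// addrC subrK.
Qed.

Let w_bound s t e : 0 <= s <= T -> 0 <= t <= T ->
  L2norm (fun x => w s t x - v t x) < e -> L2norm (w s t) <= L2norm (v t) + e.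
Proof.
move=> hs ht h.
have -> : w s t = fun x => v t x + (w s t x - v t x).
  by apply/funext => x; rewrite addrC subrK.
apply: le_trans (L2normD _ _) _; first exact: vL2.
  by apply: inL2B; [exact: wL2|exact: vL2].
by rewrite lerD2l ltW.
Qed.

(** With w the difference quotient, u(s) = u(t) + (s - t) w, so the quotient of the energy is 2 (w,
    u(t)) + (s - t) |w|^2. The first term tends to the rate because w tends to v(t), the second to 0
    because |w| stays bounded. *)
Let energy_quot t : 0 <= t <= T -> forall e, 0 < e -> exists2 d : R, 0 < d &
  forall s, 0 <= s <= T -> 0 < `|s - t| < d -> `|(E s - E t) / (s - t) - L t| < e.
Proof.
move=> ht e e0; set a := L2norm (u t); set b := L2norm (v t).
have a0 : 0 <= a by exact: L2norm_ge0.
have b0 : 0 <= b by exact: L2norm_ge0.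
(* The bound 1 gives |w| <= b + 1; the other bound makes 2 a [e1] smaller than e / 2. *)
pose e1 := Num.min 1 (e / (4 * (a + 1))).
have e10 : 0 < e1 by rewrite lt_min ltr01 divr_gt0// mulr_gt0// ltr_wpDl.
have e11 : e1 <= 1 by rewrite ge_min lexx.
have e1e : 2 * a * e1 < e / 2.
  have : e1 * (4 * (a + 1)) <= e.
    by rewrite -ler_pdivlMr ?mulr_gt0 ?ltr_wpDl// ge_min lexx orbT.
  by nra.
have [d d0 hd] := dquot_norm ht e10.
(* Chosen so that [d1] times (b + 1)^2, the bound on |w|^2, is e / 2. *)
pose d1 := e / (2 * (b + 1) ^+ 2).
have B0 : 0 < (b + 1) ^+ 2 by rewrite exprn_gt0// ltr_wpDl.
have d10 : 0 < d1 by rewrite divr_gt0// mulr_gt0.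
exists (Num.min d d1); first by rewrite lt_min d0.
move=> s hs; rewrite lt_min => /and3P[st0 std std1].
have hw : L2norm (fun x => w s t x - v t x) < e1 by apply: hd; rewrite ?st0.
have hwb := w_bound hs ht hw.
have st : s - t != 0 by rewrite -normr_gt0.
have iw := wL2 hs ht; have iu := uL2 ht; have iv := vL2 ht.
have -> : (E s - E t) / (s - t) - L t =
    2 * L2ip (fun x => w s t x - v t x) (u t) + (s - t) * L2ip (w s t) (w s t).
  rewrite /E {1 2}(usE st0) L2ip_expand// /L.
  have -> : L2ip (fun x => w s t x - v t x) (u t) = L2ip (w s t) (u t) - L2ip (v t) (u t).
    have := L2ipDl iw (inL2Z (-1) iv) iu; rewrite L2ipZl// mulN1r => <-.
    by congr (L2ip _ _); apply/funext => x; rewrite mulN1r.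
  by rewrite (L2ipC (u t)); field.
apply: le_lt_trans (ler_normD _ _) _; rewrite [e]splitr; apply: ltr_leD.
  rewrite normrM ger0_norm//; apply: le_lt_trans e1e.
  rewrite -mulrA ler_pM2l//; apply: le_trans (L2_CauchySchwarz (inL2B iw iv) iu) _.
  by rewrite mulrC ler_wpM2l// ltW.
rewrite normrM -L2norm_sqr normrX (ger0_norm (L2norm_ge0 _)).
apply: (@le_trans _ _ (d1 * (b + 1) ^+ 2)).
  apply: ler_pM; rewrite ?normr_ge0 ?sqr_ge0 ?(ltW std1)//.
  rewrite lerXn2r ?nnegrE ?L2norm_ge0 ?addr_ge0//.
  by rewrite (le_trans hwb)// lerD2l.
have -> : d1 * (b + 1) ^+ 2 = e / 2; last exact: lexx.
by rewrite /d1; field; rewrite lt0r_neq0// ltr_wpDl.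
Qed.

Let u_lip t : 0 <= t <= T -> exists2 d : R, 0 < d &
  forall s, 0 <= s <= T -> `|s - t| < d ->
    L2norm (fun x => u s x - u t x) <= `|s - t| * (L2norm (v t) + 1).
Proof.
move=> ht; have [d d0 hd] := dquot_norm ht ltr01; exists d => // s hs st.
have [->|sneqt] := eqVneq s t.
  rewrite subrr normr0 mul0r.
  rewrite (_ : (fun x => _) = (fun x => 0 * u t x)); last first.
    by apply/funext => x; rewrite subrr mul0r.
  by rewrite L2normZ ?normr0 ?mul0r//; exact: uL2.
have st0 : 0 < `|s - t| by rewrite normr_gt0 subr_eq0.
rewrite (_ : (fun x => _) = (fun x => (s - t) * w s t x)); last first.
  by apply/funext => x; rewrite (usE st0) addrC addKr.
rewrite L2normZ; last exact: wL2.
by rewrite ler_wpM2l// w_bound// hd// st0.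
Qed.

Let energy_cont t : 0 <= t <= T -> forall e, 0 < e -> exists2 d : R, 0 < d &
  forall s, 0 <= s <= T -> `|s - t| < d -> `|E s - E t| < e.
Proof.
move=> ht e e0; have [d d0 hd] := energy_quot ht ltr01.
have L0 : 0 < `|L t| + 1 by rewrite ltr_wpDl.
exists (Num.min d (e / (`|L t| + 1))); first by rewrite lt_min d0 divr_gt0.
move=> s hs; rewrite lt_min => /andP[sd se].
have [->|sneqt] := eqVneq s t; first by rewrite subrr normr0.
have st0 : 0 < `|s - t| by rewrite normr_gt0 subr_eq0.
have h : `|(E s - E t) / (s - t)| <= `|L t| + 1.
  rewrite -[X in `|X|](subrK (L t)) addrC (le_trans (ler_normD _ _))// lerD2l ltW//.
  by apply: hd => //; rewrite st0.
rewrite -[X in `|X|](divfK (_ : s - t != 0)); last by rewrite subr_eq0.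
rewrite normrM mulrC (le_lt_trans (ler_wpM2l _ h))//.
by rewrite -ltr_pdivlMr.
Qed.

Let rate_cont t : 0 <= t <= T -> forall e, 0 < e -> exists2 d : R, 0 < d &
  forall s, 0 <= s <= T -> `|s - t| < d -> `|L s - L t| < e.
Proof.
move=> ht e e0; have [d1 d10 h1] := u_lip ht.
set a := L2norm (u t); set b := L2norm (v t) in h1 *.
have a0 : 0 <= a by exact: L2norm_ge0.
have b0 : 0 <= b by exact: L2norm_ge0.
(* Bounds |v(t)| = b and also |u(s)|, which is at most a + (b + 1) once |s - t| < 1. Each of the two
   terms of the difference is then kept below e / 4, and the rate carries a factor 2. *)
pose M := a + b + 2; have M0 : 0 < M by rewrite /M ltr_wpDl ?addr_ge0.
pose e1 := e / (4 * M); have e10 : 0 < e1 by rewrite divr_gt0// mulr_gt0.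
have [d2 d20 h2] := vcont ht (exprn_gt0 2 e10).
pose d3 := Num.min 1 (e / (4 * M ^+ 2)).
have d30 : 0 < d3 by rewrite lt_min ltr01 divr_gt0// mulr_gt0// exprn_gt0.
exists (Num.min d1 (Num.min d2 d3)); first by rewrite !lt_min d10 d20 /= -lt_min.
move=> s hs; rewrite !lt_min => /and4P[s1 s2 s3 s4].
have hu := h1 s hs s1.
have hv : L2norm (fun x => v s x - v t x) < e1.
  by apply: L2sq_lt_norm => //; [apply: inL2B; exact: vL2|exact: h2].
have iu := uL2 ht; have ius := uL2 hs; have iv := vL2 ht; have ivs := vL2 hs.
have hus : L2norm (u s) <= M.
  have -> : u s = fun x => u t x + (u s x - u t x).
    by apply/funext => x; rewrite addrC subrK.
  apply: le_trans (L2normD iu (inL2B ius iu)) _.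
  rewrite /M -addrA lerD2l (le_trans hu)// (le_trans (_ : _ <= 1 * (b + 1)))//.
    by rewrite ler_wpM2r ?addr_ge0// ltW.
  by rewrite mul1r lerD2l ler1n.
have subl f g k : inL2 f -> inL2 g -> inL2 k ->
    L2ip (fun x => f x - g x) k = L2ip f k - L2ip g k.
  move=> hf hg hk; have := L2ipDl hf (inL2Z (-1) hg) hk; rewrite L2ipZl// mulN1r => <-.
  by congr (L2ip _ _); apply/funext => x; rewrite mulN1r.
have -> : L s - L t = 2 * (L2ip (fun x => v s x - v t x) (u s)
    + L2ip (fun x => u s x - u t x) (v t)).
  by rewrite !subl// /L !(L2ipC _ (v t)); ring.
rewrite normrM ger0_norm// -ltr_pdivlMl//.
apply: le_lt_trans (ler_normD _ _) _.
have -> : 2^-1 * e = e / 4 + e / 4 by field.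
apply: ler_ltD.
  apply: le_trans (L2_CauchySchwarz (inL2B ivs iv) ius) _.
  apply: (@le_trans _ _ (e1 * M)).
    by apply: ler_pM; rewrite ?L2norm_ge0// ltW.
  by rewrite /e1 invfM mulrA mulfVK// lt0r_neq0.
apply: le_lt_trans (L2_CauchySchwarz (inL2B ius iu) iv) _.
apply: (@le_lt_trans _ _ (`|s - t| * M * M)).
  apply: ler_pM; rewrite ?L2norm_ge0//.
    by rewrite (le_trans hu)// ler_wpM2l// /M; lra.
  by rewrite -/b /M; lra.
rewrite -mulrA -expr2 -ltr_pdivlMr ?exprn_gt0//.
by rewrite -mulrA -invfM.
Qed.

Lemma within_itv_continuous_eps (f : R -> R) (a b : R) :
  (forall t, a <= t <= b -> forall e, 0 < e -> exists2 d : R, 0 < d &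
     forall s, a <= s <= b -> `|s - t| < d -> `|f s - f t| < e) ->
  {within `[a, b], continuous f}.
Proof.
move=> h; apply/subspace_continuousP => t /=; rewrite in_itv /= => ht.
apply/cvgrPdist_lt => e e0; have [d d0 hd] := h t ht e e0.
rewrite near_withinE; exists d => //= s /= st; rewrite in_itv /= => hs.
by rewrite distrC; apply: hd => //; rewrite distrC.
Qed.

(** The rate enters with a minus sign because this is the upper bound that the scheme gives for the
    dissipation. The open interval is the one on which the equations of the scheme are available;
    continuity of the energy on [0, T] still yields the end values. *)
Theorem energy_FTC :
  measurable_fun `]0, T[ (fun t => (- (2 * L2ip (v t) (u t)))%:E) /\
  (\int[@lebesgue_measure R]_(t in `]0%R, T[) (- (2 * L2ip (v t) (u t)))%:E
   = (L2ip (u 0%R) (u 0%R) - L2ip (u T) (u T))%:E)%E.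
Proof.
have cE : {within `[0, T], continuous E} by exact: within_itv_continuous_eps.
have dE t : t \in `]0, T[ -> is_derive t 1 E (L t).
  rewrite in_itv /= => /andP[t0 tT].
  have ht : 0 <= t <= T by rewrite !ltW.
  have c : h^-1 *: ((E \o shift t) (h *: 1) - E t) @[h --> 0^'] --> L t.
    apply/cvgrPdist_lt => e e0; have [d d0 hd] := energy_quot ht e0.
    (* Keeps t + h inside [0, T], where the hypotheses on difference quotients apply. *)
    pose d' := Num.min d (Num.min t (T - t)).
    have d'0 : 0 < d' by rewrite !lt_min d0 t0 subr_gt0.
    exists d' => //= h /=; rewrite sub0r normrN => hd' h0.
    move: hd'; rewrite !lt_min => /and3P[h1 h2 h3].
    have := hd (h + t); rewrite addrK h1 normr_gt0 h0 => H.
    rewrite distrC /= /shift /= [h *: 1]mulr1 [_ *: _]mulrC; apply: H => //.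
    move: h2 h3; rewrite !ltr_norml => /andP[? ?] /andP[? ?]; lra.
  split; first by apply/cvg_ex; exists (L t).
  exact: cvg_lim.
have [_ cl cr] := (continuous_within_itvP E T0).1 cE.
have cL : {within `[0, T], continuous L} by exact: within_itv_continuous_eps.
have iL : (@lebesgue_measure R).-integrable `[0, T] (EFin \o L).
  by apply: continuous_compact_integrable => //; exact: segment_compact.
have mL : measurable_fun `]0, T[ (EFin \o L).
  have [mL _] := integrableP _ _ _ iL; apply: measurable_funS mL => //.
  by move=> x /=; rewrite !in_itv /= => /andP[/ltW -> /ltW ->].
split; first by have := measurableT_comp (@oppe_measurable R setT) mL.
rewrite -(@integral_itv_bndoo _ _ _ _ true false); last by have := measurableT_comp (@oppe_measurable R setT) mL.
have -> : (\int[@lebesgue_measure R]_(t in `[0%R, T]) (- (2 * L2ip (v t) (u t)))%:E =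
  (-1)%:E * \int[@lebesgue_measure R]_(t in `[0%R, T]) (L t)%:E)%E.
  rewrite -integralZl//; apply: eq_integral => t _.
  by rewrite -EFinM mulN1r.
rewrite (@continuous_FTC2 _ L E 0 T T0)//.
- by rewrite -EFinB -EFinM mulN1r opprB.
- by split => // t /dE; case.
- by move=> t /dE; rewrite derive1E; case.
Qed.

End EnergyDerivative.

(** * Primitives and numerical fluxes *)

Section Primitives.
Variable R : realType.
Local Notation leb := (@lebesgue_measure R).

Lemma lipschitz_bound (f : R -> R) : lipschitz f ->
  exists2 L : R, 0 <= L & forall x y, `|f x - f y| <= L * `|x - y|.
Proof.
move=> [M [Mr H]]; exists (Num.max M 0 + 1).
  by rewrite addr_ge0// le_max lexx orbT.
move=> x y; apply: (H (Num.max M 0 + 1) _ (x, y)) => //.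
by rewrite ltr_pwDr// le_max lexx.
Qed.

Lemma bound_continuous (f : R -> R) (L : R) :
  (forall x y, `|f x - f y| <= L * `|x - y|) -> continuous f.
Proof.
move=> h x; apply/cvgrPdist_lt => e e0.
have L1 : 0 < `|L| + 1 by rewrite ltr_wpDl.
exists (e / (`|L| + 1)); first by rewrite /= divr_gt0.
move=> y /=; rewrite ltr_pdivlMr// => hy.
apply: le_lt_trans (h x y) (le_lt_trans _ hy).
rewrite mulrC ler_wpM2l// (le_trans (ler_norm _))// lerDl//.
Qed.

(** Replaces the case distinction on the sign of u by one integral with a fixed lower end and a
    constant, so that the fundamental theorem also applies at and across 0. *)
Lemma int0E (h : R -> R) (B u : R) : continuous h -> 0 < B -> - B <= u ->
  int0 h u = \int[leb]_(s in `[- B, u]) h s - \int[leb]_(s in `[- B, 0]) h s.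
Proof.
move=> ch B0 Bu; rewrite /int0; case: ifPn => [u0|/negPf u0].
  rewrite Rintegral_itvB//; [|exact: continuous_integrable_itv|..]; rewrite ?bnd_simp ?oppr_le0 ?(ltW B0)//.
  by rewrite Rintegral_itv_obnd_cbnd//; exact: continuous_integrable_itv.
have u0' : u < 0 by rewrite ltNge u0.
rewrite -[RHS]opprB Rintegral_itvB//; [|exact: continuous_integrable_itv|..]; rewrite ?bnd_simp ?(ltW u0')//.
by rewrite Rintegral_itv_obnd_cbnd//; exact: continuous_integrable_itv.
Qed.

Lemma is_derive_int0 (h : R -> R) (x : R) : continuous h ->
  is_derive x (1 : R) (int0 h) (h x).
Proof.
move=> ch; pose B := `|x| + 1; have B0 : 0 < B by rewrite ltr_wpDl.
have Bx : - B < x.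
  by rewrite ltrNl (le_lt_trans (ler_norm _))// normrN ltrDl.
have [dF F'] := @continuous_FTC1_closed R h (- B) x (x + 1) (ltr_pwDr ltr01 (lexx x))
  (continuous_integrable_itv _ _ _ _ ch) Bx (ch x).
pose P := fun u : R => \int[leb]_(s in `[- B, u]) h s.
have dP : is_derive x (1 : R) (P - cst (P 0)) (h x).
  have : is_derive x (1 : R) P (h x) by split => //; rewrite -derive1E.
  by move=> dP; have := is_deriveB dP (is_derive_cst (P 0) x (1 : R)); rewrite subr0.
apply: near_eq_is_derive dP.
near=> u; rewrite (@int0E _ B)// ltW//.
by near: u; exact: lt_nbhsr.
Unshelve. all: by end_near.
Qed.

Lemma int00 (h : R -> R) : int0 h 0 = 0.
Proof. by rewrite /int0 lexx set_itv1 Rintegral_set1. Qed.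

Lemma int0_MVT (h : R -> R) x y : continuous h ->
  exists2 z, Num.min x y <= z <= Num.max x y & int0 h y - int0 h x = h z * (y - x).
Proof.
move=> ch; have d z : is_derive z (1 : R) (int0 h) (h z) by exact: is_derive_int0.
have ci : continuous (int0 h).
  by move=> z; apply/differentiable_continuous/derivable1_diffP; case: (d z).
have H u v : u <= v -> exists2 z, u <= z <= v & int0 h v - int0 h u = h z * (v - u).
  move=> uv; have [|z + ->] := @MVT_segment _ (int0 h) h u v uv (fun z _ => d z).
    exact: continuous_subspaceT.
  by rewrite in_itv /= => ?; exists z.
have [xy|/ltW yx] := leP x y; first exact: H.
have [z hz e] := H _ _ yx; exists z => //.
by rewrite -[LHS]opprB e -mulrN opprB.
Qed.

End Primitives.

Section Fluxes.
Variables (R : realType) (f a : R -> R) (fhat : R -> R -> R) (c12 : R -> R -> R -> R -> R).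
Variables (Lf M Lh Lc : R).
Hypothesis Lf0 : 0 <= Lf.
Hypothesis flip : forall x y, `|f x - f y| <= Lf * `|x - y|.
Hypothesis f00 : f 0 = 0.
Hypothesis ac : continuous a.
Hypothesis a0 : forall s, 0 <= a s.
Hypothesis M0 : 0 <= M.
Hypothesis aM : forall s, Num.sqrt (a s) <= M.
Hypothesis Lh0 : 0 <= Lh.
Hypothesis hlip : forall x y x' y', `|fhat x y - fhat x' y'| <= Lh * (`|x - x'| + `|y - y'|).
Hypothesis hcons : forall s, fhat s s = f s.
Hypothesis hmono1 : forall x x' y, x <= x' -> fhat x y <= fhat x' y.
Hypothesis hmono2 : forall x y y', y <= y' -> fhat x y' <= fhat x y.
Hypothesis Lc0 : 0 <= Lc.
Hypothesis clip : forall p1 p2 p3 p4 r1 r2 r3 r4,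
  `|c12 p1 p2 p3 p4 - c12 r1 r2 r3 r4|
       <= Lc * (`|p1 - r1| + `|p2 - r2| + `|p3 - r3| + `|p4 - r4|).
Hypothesis c00 : c12 0 0 0 0 = 0.

Let fc : continuous f. Proof. exact: bound_continuous flip. Qed.

Lemma sqrta_continuous : continuous (fun s => Num.sqrt (a s)).
Proof. by move=> s; apply: continuous_comp; [exact: ac|exact: sqrt_continuous]. Qed.

Lemma ratioF_jump um up : ratioF f um up * (up - um) = Fprim f up - Fprim f um.
Proof.
rewrite /ratioF; case: eqP => [->|/eqP h]; first by rewrite !subrr mulr0.
by rewrite divfK// subr_eq0.
Qed.

Lemma ratiog_jump um up : ratiog a um up * (up - um) = gfun a up - gfun a um.
Proof.
rewrite /ratiog; case: eqP => [->|/eqP h]; first by rewrite !subrr mulr0.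
by rewrite divfK// subr_eq0.
Qed.

(** The quantity equals [F] - fhat(u^-, u^+) [u] = (f(z) - fhat(u^-, u^+)) [u] for some z between
    the traces. Writing f(z) = fhat(z, z) and moving one argument at a time, monotonicity gives the
    first factor the sign of [u]. *)
Lemma c11_jump_ge0 um up : 0 <= c11 f fhat um up * (up - um) ^+ 2.
Proof.
have [->|h] := eqVneq up um; first by rewrite subrr expr0n mulr0.
have h' : up - um != 0 by rewrite subr_eq0.
have -> : c11 f fhat um up * (up - um) ^+ 2 =
    ratioF f um up * (up - um) - fhat um up * (up - um).
  by rewrite /c11; field.
rewrite ratioF_jump; have [z] := int0_MVT um up fc; rewrite /Fprim => hz ->.
rewrite -mulrBl -hcons.
have [ul|/ltW ul] := leP um up; move: hz.
  rewrite (min_idPl ul) (max_idPr ul) => /andP[z1 z2].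
  rewrite mulr_ge0// ?subr_ge0//.
  exact: le_trans (hmono1 _ z1) (hmono2 _ z2).
rewrite (min_idPr ul) (max_idPl ul) => /andP[z1 z2].
rewrite mulr_le0// ?subr_le0//.
exact: le_trans (hmono2 _ z1) (hmono1 _ z2).
Qed.

Lemma Fprim_bound s : `|Fprim f s| <= Lf * s ^+ 2.
Proof.
have [z hz] := int0_MVT 0 s fc; rewrite int00 !subr0 /Fprim => ->.
have fz : `|f z| <= Lf * `|z| by have := flip z 0; rewrite f00 !subr0.
have zs : `|z| <= `|s|.
  move: hz; have [s0|/ltW s0] := leP 0 s.
    by move=> /andP[? ?]; rewrite !ger0_norm.
  by move=> /andP[? ?]; rewrite !ler0_norm// lerN2.
rewrite normrM -(real_normK (num_real s)) expr2 mulrA ler_wpM2r//.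
by rewrite (le_trans fz)// ler_wpM2l.
Qed.

Lemma gfun_bound s t : `|gfun a s - gfun a t| <= M * `|s - t|.
Proof.
have [z _] := int0_MVT t s sqrta_continuous; rewrite /gfun => ->.
by rewrite normrM ler_wpM2r// ger0_norm ?sqrtr_ge0.
Qed.

Lemma gfun_bound0 s : `|gfun a s| <= M * `|s|.
Proof. by have := gfun_bound s 0; rewrite {2}/gfun int00 !subr0. Qed.

Lemma ratiog_bound um up : `|ratiog a um up| <= M.
Proof.
rewrite /ratiog; case: eqP => [_|/eqP h]; first by rewrite ger0_norm ?sqrtr_ge0.
rewrite normrM normfV ler_pdivrMr ?normr_gt0 ?subr_eq0//.
exact: gfun_bound.
Qed.

(** For distinct traces the [c11] correction cancels the difference quotient and leaves fhat(u^-,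
    u^+), of linear growth because fhat(0, 0) = f(0) = 0. For equal traces what remains is
    f(u^-). *)
Lemma convective_flux_bound um up :
  `|ratioF f um up - c11 f fhat um up * (up - um)| <= (Lh + Lf) * (`|um| + `|up|).
Proof.
have s0 : 0 <= `|um| + `|up| by rewrite addr_ge0.
have [->|h] := eqVneq up um.
  rewrite subrr mulr0 subr0 /ratioF eqxx.
  have := flip um 0; rewrite f00 !subr0 => /le_trans; apply.
  by rewrite mulrDl mulrDr; have := mulr_ge0 Lf0 (normr_ge0 um);
     have := mulr_ge0 Lh0 (addr_ge0 (normr_ge0 um) (normr_ge0 um)); lra.
rewrite /c11 divfK ?subr_eq0// opprB addrC subrK.
have := hlip um up 0 0; rewrite hcons f00 !subr0 => /le_trans; apply.
by rewrite ler_wpM2r// lerDl.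
Qed.

Lemma c12_bound p1 p2 p3 p4 :
  `|c12 p1 p2 p3 p4| <= Lc * (`|p1| + `|p2| + `|p3| + `|p4|).
Proof. by have := clip p1 p2 p3 p4 0 0 0 0; rewrite c00 !subr0. Qed.

(** The estimated expression is the boundary term of the cell identity, read with the traces from
    the right. Each product is quadratic in the traces, except those with [c12], which are cubic. *)
Lemma flux_potential_bound : exists2 K : R, 0 <= K & forall um qm up qp : R,
  let S := `|um| + `|qm| + `|up| + `|qp| in
  `|- Fprim f up + gfun a up * qp +
    (ratioF f um up - ratiog a um up * avg qm qp
     - c11 f fhat um up * (up - um) - c12 um qm up qp * (qp - qm)) * up +
    (- avg (gfun a um) (gfun a up) + c12 um qm up qp * (up - um)) * qp|
   <= K * (S ^+ 2 + S ^+ 3).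
Proof.
(* Over the seven partial estimates below no constant occurs more than three times; [M] does so
   exactly. *)
exists (3 * (Lf + M + Lh + Lc)); first by rewrite mulr_ge0// !addr_ge0.
move=> um qm up qp /=; set S := `|um| + `|qm| + `|up| + `|qp|.
have [um0 qm0 up0 qp0] := And4 (normr_ge0 um) (normr_ge0 qm) (normr_ge0 up) (normr_ge0 qp).
have S0 : 0 <= S by rewrite /S !addr_ge0.
have S2 : 0 <= S ^+ 2 by rewrite sqr_ge0.
have S3 : 0 <= S ^+ 3 by rewrite exprn_ge0.
have [umS qmS upS qpS] : [/\ `|um| <= S, `|qm| <= S, `|up| <= S & `|qp| <= S].
  by rewrite /S; split; lra.
have e1 : `|Fprim f up| <= Lf * S ^+ 2.
  rewrite (le_trans (Fprim_bound _))// ler_wpM2l// -(real_normK (num_real up)).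
  by rewrite lerXn2r// nnegrE.
have gS s : `|s| <= S -> `|gfun a s| <= M * S.
  by move=> h; rewrite (le_trans (gfun_bound0 _))// ler_wpM2l.
have e2 : `|gfun a up * qp| <= M * S ^+ 2.
  by rewrite normrM expr2 mulrA ler_pM// gS.
have av (x y B : R) : `|x| <= B -> `|y| <= B -> `|avg x y| <= B.
  move=> hx hy; rewrite /avg normrM (ger0_norm (_ : 0 <= 2^-1)) ?invr_ge0//.
  by rewrite ler_pdivrMr// (le_trans (ler_normD _ _))//; lra.
have jp (x y : R) : `|x| + `|y| <= S -> `|x - y| <= S.
  by move=> h; rewrite (le_trans (ler_normB _ _)).
have cS : `|c12 um qm up qp| <= Lc * S by exact: c12_bound.
have e3 : `|(ratioF f um up - c11 f fhat um up * (up - um)) * up| <= (Lh + Lf) * S ^+ 2.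
  rewrite normrM expr2 mulrA ler_pM//.
  rewrite (le_trans (convective_flux_bound _ _))// ler_wpM2l ?addr_ge0//.
  by rewrite /S; lra.
have mul3 (x y z A B C : R) : `|x| <= A -> `|y| <= B -> `|z| <= C -> `|x * y * z| <= A * B * C.
  by move=> xA yB zC; rewrite !normrM !ler_pM// mulr_ge0.
have e4 : `|ratiog a um up * avg qm qp * up| <= M * S ^+ 2.
  by rewrite (_ : M * S ^+ 2 = M * S * S); [apply: mul3; [exact: ratiog_bound|exact: av|]|ring].
have e5 : `|c12 um qm up qp * (qp - qm) * up| <= Lc * S ^+ 3.
  rewrite (_ : Lc * S ^+ 3 = Lc * S * S * S); last by ring.
  by apply: mul3 => //; apply: jp; rewrite /S; lra.
have e6 : `|avg (gfun a um) (gfun a up) * qp| <= M * S ^+ 2.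
  by rewrite normrM expr2 mulrA ler_pM// av// gS.
have e7 : `|c12 um qm up qp * (up - um) * qp| <= Lc * S ^+ 3.
  rewrite (_ : Lc * S ^+ 3 = Lc * S * S * S); last by ring.
  by apply: mul3 => //; apply: jp; rewrite /S; lra.
have z1 : 0 <= Lf * S ^+ 3 by rewrite mulr_ge0.
have z2 : 0 <= M * S ^+ 3 by rewrite mulr_ge0.
have z3 : 0 <= Lh * S ^+ 3 by rewrite mulr_ge0.
have z4 : 0 <= Lc * S ^+ 2 by rewrite mulr_ge0.
have z5 : 0 <= Lh * S ^+ 2 by rewrite mulr_ge0.
have z6 : 0 <= Lf * S ^+ 2 by rewrite mulr_ge0.
have z7 : 0 <= Lc * S ^+ 3 by rewrite mulr_ge0.
move: e1 e2 e3 e4 e5 e6 e7; rewrite !ler_norml => /andP[? ?] /andP[? ?] /andP[? ?] /andP[? ?]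
  /andP[? ?] /andP[? ?] /andP[? ?].
by apply/andP; split; lra.
Qed.

End Fluxes.

(** * Cell energy identity *)

Section CellSums.
Variable R : realType.

Lemma cell_sum_telescope (P : int -> R) N :
  cell_sum (fun i => P i - P (i + 1)) N = P (- N%:Z) - P N%:Z.
Proof.
elim: N => [|N IH]; first by rewrite /cell_sum big_ord0 oppr0 subrr.
rewrite /cell_sum big_ord_recr /= -/(cell_sum (fun i => P i - P (i + 1)) N) IH.
have -> : Negz N + 1 = - N%:Z by rewrite NegzE; lia.
have -> : N%:Z + 1 = N.+1%:Z by lia.
by rewrite -NegzE; ring.
Qed.

Lemma cell_sumD (F G : int -> R) N :
  cell_sum (fun i => F i + G i) N = cell_sum F N + cell_sum G N.
Proof. by rewrite /cell_sum -big_split /=; apply: eq_bigr => i _; ring. Qed.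

Lemma cell_sumZ (a : R) (F : int -> R) N :
  cell_sum (fun i => a * F i) N = a * cell_sum F N.
Proof. by rewrite /cell_sum mulr_sumr; apply: eq_bigr => i _; ring. Qed.

Lemma eq_cell_sum (F G : int -> R) N : F =1 G -> cell_sum F N = cell_sum G N.
Proof. by move=> h; apply: eq_bigr => i _; rewrite !h. Qed.

Lemma cell_sum_cvg_terms (F : int -> R) (l : R) : (forall i, 0 <= F i) ->
  cell_sum F N @[N --> \oo] --> l ->
  F (Posz n) @[n --> \oo] --> 0 /\ F (Negz n) @[n --> \oo] --> 0.
Proof.
move=> F0 h; pose u n := F (Posz n) + F (Negz n).
have u0 : u n @[n --> \oo] --> 0.
  apply: cvg_series_cvg_0; apply/cvg_ex; exists l.
  apply: cvg_trans h; apply: near_eq_cvg; apply: nearW => n.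
  by rewrite /series /= /cell_sum big_mkord.
split; apply: (squeeze_cvgr _ _ u0); try exact: cvg_cst.
  by apply: nearW => n; rewrite F0 lerDl F0.
by apply: nearW => n; rewrite F0 lerDr F0.
Qed.

Definition window_seq N : seq int := map Posz (iota 0 N) ++ map Negz (iota 0 N).

Lemma cell_sum_window_seq (F : int -> R) N :
  cell_sum F N = \sum_(i <- window_seq N) F i.
Proof.
rewrite /window_seq big_cat !big_map /= /cell_sum big_split /=.
have e (G : nat -> R) : \sum_(i < N) G i = \sum_(i <- iota 0 N) G i.
  by rewrite -(big_mkord xpredT G) /index_iota subn0.
by rewrite (e (fun i => F (Posz i))) (e (fun i => F (Negz i))).
Qed.

Lemma uniq_window_seq N : uniq (window_seq N).
Proof.
rewrite cat_uniq !map_inj_uniq ?iota_uniq ?andbT//=; last by move=> x y [].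
  by apply/hasPn => x /mapP[n _ ->]; apply/mapP => -[].
by move=> x y [].
Qed.

Lemma mem_window_seq N i : (`|i| < N)%N -> i \in window_seq N.
Proof.
case: i => n h; rewrite mem_cat; apply/orP; [left|right]; apply: map_f;
by rewrite mem_iota /= add0n //; apply: ltnW.
Qed.

Lemma ler_sum_uniq_subset (F : int -> R) (s t : seq int) : (forall i, 0 <= F i) ->
  uniq s -> uniq t -> {subset s <= t} -> \sum_(i <- s) F i <= \sum_(i <- t) F i.
Proof.
move=> F0 us ut st; rewrite [leRHS](bigID (mem s)) /= -[X in _ <= X + _]big_filter.
rewrite [X in _ <= X + _](perm_big s) /=; first by rewrite lerDl sumr_ge0.
apply: uniq_perm => //; first exact: filter_uniq.
move=> x; rewrite mem_filter; apply/andP/idP => [[]//|xs]; split => //; exact: st.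
Qed.

(** The shift by one is imposed by the cell identity, which assigns to cell i the jump at its right
    end. Any finite set of indices lies in a window, so bounding the window sums suffices. *)
Lemma esum_int_le (F : int -> R) (l : R) : (forall i, 0 <= F i) ->
  cell_sum (fun i => F (i + 1)) N @[N --> \oo] --> l ->
  (\esum_(i in [set: int]) (F i)%:E <= l%:E)%E.
Proof.
move=> F0 h.
have nd : {homo (cell_sum (fun i => F (i + 1))) : n m / (n <= m)%N >-> n <= m}.
  apply/nondecreasing_seqP => n.
  by rewrite /cell_sum big_ord_recr /= lerDl addr_ge0.
have le_l N : cell_sum F N <= l.
  rewrite -(cvg_lim _ h)//; apply: le_trans (nondecreasing_cvgn_le nd _ N.+1); last first.
    by apply/cvg_ex; exists l.
  rewrite /cell_sum big_ord_recr /= -/(cell_sum (fun i => F (i + 1)) N).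
  (* Undoing the shift adds F(-N) - F(N). The term F(-N) is one of the two that the shifted sum
     gains from N to N+1, so that larger sum is an upper bound. *)
  have := cell_sum_telescope F N.
  rewrite (@eq_cell_sum _ (fun i => F i + (-1) * F (i + 1))); last by move=> i; rewrite mulN1r.
  rewrite cell_sumD cell_sumZ => e; rewrite -/(cell_sum F N).
  have -> : Negz N + 1 = - N%:Z by rewrite NegzE; lia.
  by have := F0 N%:Z; have := F0 (N%:Z + 1); lra.
apply: ge_ereal_sup => _ [A [finA _] <-].
rewrite fsbig_finite//= sumEFin lee_fin.
pose sA : seq int := finmap.enum_fset (fset_set A).
pose N := (\max_(i <- sA) `|i|%N).+1.
apply: le_trans (le_l N); rewrite cell_sum_window_seq.
apply: (@ler_sum_uniq_subset _ sA) => //; [exact: finmap.fset_uniq|exact: uniq_window_seq|].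
move=> i iA; apply: mem_window_seq; rewrite ltnS.
exact: (@leq_bigmax_seq _ _ xpredT (fun i : int => `|i|%N)).
Qed.

End CellSums.

Section EnergyBalance.
Variables (R : realType) (dx : R) (k : nat).
Hypothesis dx0 : 0 < dx.
Local Notation leb := (@lebesgue_measure R).

Definition cell_mass (U : int -> {poly R}) i : R := \int[leb]_(x in cellI dx i) ((U i).[x] ^+ 2).

Lemma VkL2_inL2 U : VkL2 dx k U -> inL2 (evV dx U).
Proof. by move=> [_ h]; split => //; exact: measurable_evV. Qed.

Lemma cell_mass_ge0 U i : 0 <= cell_mass U i.
Proof. by apply: Rintegral_ge0 => x _; rewrite sqr_ge0. Qed.

Lemma cvg_cell_sum_L2ip U V : VkL2 dx k U -> VkL2 dx k V ->
  cell_sum (fun i => \int[leb]_(x in cellI dx i) ((U i).[x] * (V i).[x])) N @[N --> \oo]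
    --> L2ip (evV dx U) (evV dx V).
Proof.
move=> /VkL2_inL2 hU /VkL2_inL2 hV.
have := cvg_cell_sum_Rintegral dx0 (integrable_mul_L2 hU hV).
apply: cvg_trans; apply: near_eq_cvg; apply: nearW => N.
apply: eq_cell_sum => i; apply: eq_Rintegral => x; rewrite inE => hx.
by rewrite !(evV_cellI dx0 _ hx).
Qed.

Lemma cvg_cell_sum_mass U : VkL2 dx k U ->
  cell_sum (cell_mass U) N @[N --> \oo] --> L2ip (evV dx U) (evV dx U).
Proof.
move=> hU; have := cvg_cell_sum_L2ip hU hU.
apply: cvg_trans; apply: near_eq_cvg; apply: nearW => N.
by apply: eq_cell_sum => i; apply: eq_Rintegral => x _; rewrite expr2.
Qed.

Lemma cell_inverse_ineq : exists2 C : R, 0 <= C & forall U, Vk k U -> forall i x y,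
  xg dx i <= x <= xg dx (i + 1) -> xg dx i <= y <= xg dx (i + 1) ->
  (U i).[x] ^+ 2 <= C * cell_mass U i /\
  ((U i).[y] - (U i).[x]) ^+ 2 <= C * cell_mass U i * (y - x) ^+ 2.
Proof.
have [C C0 hC] := poly_inverse_ineq dx0 k.+1; exists C => // U hU i x y.
by rewrite /cell_mass /cellI xgS; exact: hC.
Qed.

Let xg_cell i : xg dx i <= xg dx i <= xg dx (i + 1).
Proof. by rewrite lexx xgS lerDl ltW. Qed.

Let xg_cell1 i : xg dx (i + 1) <= xg dx (i + 1) <= xg dx (i + 1) /\
  xg dx i <= xg dx (i + 1) <= xg dx (i + 1).
Proof. by rewrite lexx xgS lerDl ltW. Qed.

Lemma traces_le_mass : exists2 C : R, 0 <= C & forall U, Vk k U -> forall i,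
  trP dx U i ^+ 2 <= C * cell_mass U i /\ trM dx U (i + 1) ^+ 2 <= C * cell_mass U i.
Proof.
have [C C0 hC] := cell_inverse_ineq; exists C => // U hU i; split.
  exact: (hC U hU i _ _ (xg_cell i) (xg_cell i)).1.
rewrite /trM addrK.
exact: (hC U hU i _ _ (xg_cell1 i).2 (xg_cell1 i).2).1.
Qed.

Let cvg_sqr_le (C : R) (x m : nat -> R) : (forall n, x n ^+ 2 <= C * m n) ->
  m n @[n --> \oo] --> 0 -> `|x n| @[n --> \oo] --> 0.
Proof.
move=> h m0.
have c : Num.sqrt (C * m n) @[n --> \oo] --> Num.sqrt (C * 0).
  apply: (@cvg_comp _ _ _ (fun n => C * m n) (@Num.sqrt R)); last exact: sqrt_continuous.
  by apply: cvgMr; exact: m0.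
rewrite mulr0 sqrtr0 in c.
apply: (squeeze_cvgr _ _ c); last exact: cvg_cst.
by apply: nearW => n; rewrite normr_ge0 -sqrtr_sqr ler_wsqrtr.
Qed.

Lemma cvg_traces U : VkL2 dx k U ->
  [/\ `|trP dx U n.+1%:Z| @[n --> \oo] --> 0, `|trM dx U n.+1%:Z| @[n --> \oo] --> 0,
      `|trP dx U (- n.+1%:Z)| @[n --> \oo] --> 0 & `|trM dx U (- n.+1%:Z)| @[n --> \oo] --> 0].
Proof.
move=> hU; have [Vk_U _] := hU.
have [C C0 hC] := traces_le_mass.
have [m1 m2] := cell_sum_cvg_terms (cell_mass_ge0 U) (cvg_cell_sum_mass hU).
split.
- apply: (@cvg_sqr_le C _ (fun n => cell_mass U n.+1%:Z)) => [n|].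
    exact: (hC U Vk_U _).1.
  by have := m1; rewrite -cvg_shiftS.
- apply: (@cvg_sqr_le C _ (fun n => cell_mass U n%:Z)) => [n|//].
  by have := (hC U Vk_U n%:Z).2; rewrite -PoszD addn1.
- apply: (@cvg_sqr_le C _ (fun n => cell_mass U (Negz n))) => [n|//].
  by rewrite -NegzE; exact: (hC U Vk_U _).1.
(* The left trace at the grid point -(n+1) is read in the cell -(n+2), that is [Negz n.+1]. *)
- apply: (@cvg_sqr_le C _ (fun n => cell_mass U (Negz n.+1))) => [n|].
    have := (hC U Vk_U (Negz n.+1)).2.
    by rewrite (_ : Negz n.+1 + 1 = - n.+1%:Z)// NegzE; lia.
  by have := m2; rewrite -cvg_shiftS.
Qed.

Variables (f a : R -> R) (fhat : R -> R -> R) (c12 : R -> R -> R -> R -> R).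
Variables (Lf M Lh Lc : R).
Hypothesis Lf0 : 0 <= Lf.
Hypothesis flip : forall x y, `|f x - f y| <= Lf * `|x - y|.
Hypothesis f00 : f 0 = 0.
Hypothesis ac : continuous a.
Hypothesis M0 : 0 <= M.
Hypothesis aM : forall s, Num.sqrt (a s) <= M.
Hypothesis Lh0 : 0 <= Lh.
Hypothesis hlip : forall x y x' y', `|fhat x y - fhat x' y'| <= Lh * (`|x - x'| + `|y - y'|).
Hypothesis hcons : forall s, fhat s s = f s.
Hypothesis hmono1 : forall x x' y, x <= x' -> fhat x y <= fhat x' y.
Hypothesis hmono2 : forall x y y', y <= y' -> fhat x y' <= fhat x y.
Hypothesis Lc0 : 0 <= Lc.
Hypothesis clip : forall p1 p2 p3 p4 r1 r2 r3 r4,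
  `|c12 p1 p2 p3 p4 - c12 r1 r2 r3 r4|
       <= Lc * (`|p1 - r1| + `|p2 - r2| + `|p3 - r3| + `|p4 - r4|).
Hypothesis c00 : c12 0 0 0 0 = 0.

Variables (U V Q : int -> {poly R}) (B : int -> R).

(* The boundary term left at x_i by testing with (u, q), read with traces (s, p). *)
Definition flux_potential i s p : R :=
  - Fprim f s + gfun a s * p + hhat_u dx f a fhat c12 U Q i * s
  + hhat_q dx a c12 U Q i * p.

(** The fluxes are designed for this: [F] cancels against the difference quotient of F, the averages
    cancel [g q] by the product rule for jumps, and the two [c12] terms cancel by skew-symmetry. *)
Lemma flux_potential_jump i :
  flux_potential i (trM dx U i) (trM dx Q i) =
  flux_potential i (trP dx U i) (trP dx Q i) + quadC dx f fhat c12 U Q i.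
Proof.
rewrite /flux_potential /quadC /hhat_u /hhat_q /=.
set um := trM dx U i; set up := trP dx U i; set qm := trM dx Q i; set qp := trP dx Q i.
have hF := ratioF_jump f um up; have hg := ratiog_jump a um up.
set F1 := Fprim f up in hF *; set F2 := Fprim f um in hF *.
set g1 := gfun a up in hg *; set g2 := gfun a um in hg *.
set rF := ratioF _ _ _ in hF *; set rg := ratiog _ _ _ in hg *.
have -> : F1 = F2 + rF * (up - um) by rewrite hF; ring.
have -> : g1 = g2 + rg * (up - um) by rewrite hg; ring.
by rewrite /avg; field.
Qed.

Lemma cvg_flux_potential : VkL2 dx k U -> VkL2 dx k Q ->
  let P i := flux_potential i (trP dx U i) (trP dx Q i) in
  P n.+1%:Z @[n --> \oo] --> 0 /\ P (- n.+1%:Z) @[n --> \oo] --> 0.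
Proof.
move=> hU hQ P.
have [K K0 hK] := flux_potential_bound Lf0 flip f00 ac M0 aM Lh0 hlip hcons Lc0 clip c00.
pose S i := `|trM dx U i| + `|trM dx Q i| + `|trP dx U i| + `|trP dx Q i|.
have hP i : `|P i| <= K * (S i ^+ 2 + S i ^+ 3) by exact: hK.
have H (s : nat -> int) : S (s n) @[n --> \oo] --> 0 -> P (s n) @[n --> \oo] --> 0.
  move=> S0; apply: norm_cvg0.
  have c : K * (S (s n) ^+ 2 + S (s n) ^+ 3) @[n --> \oo] --> K * (0 ^+ 2 + 0 ^+ 3).
    apply: cvgMr; apply: cvgD; rewrite ?expr2 ?exprS ?expr0 ?mulr1.
      by apply: (@cvgM _ _ _ _ (fun n => S (s n)) (fun n => S (s n))).
    by do 2 apply: (@cvgM _ _ _ _ (fun n => S (s n))) => //.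
  rewrite !expr0n /= addr0 mulr0 in c.
  apply: (squeeze_cvgr _ _ c); last exact: cvg_cst.
  by apply: nearW => n; rewrite normr_ge0 hP.
have [u1 u2 u3 u4] := cvg_traces hU; have [q1 q2 q3 q4] := cvg_traces hQ.
split; apply: (H (fun n => _)); rewrite /S -[0](addr0 0) -[X in _ --> X + _](addr0 0)
  -[X in _ --> X + _ + _](addr0 0); by do 3 (apply: cvgD => //).
Qed.

Hypothesis eq_u : forall i,
  (\int[leb]_(x in cellI dx i) ((V i).[x] * (U i).[x]))
     - (\int[leb]_(x in cellI dx i)
          ((f (U i).[x] - Num.sqrt (a (U i).[x]) * (Q i).[x]) * ((U i)^`()).[x]))
     + hhat_u dx f a fhat c12 U Q (i + 1) * (U i).[xg dx (i + 1)]
     - hhat_u dx f a fhat c12 U Q i * (U i).[xg dx i] = B i.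
Hypothesis eq_q : forall i,
  (\int[leb]_(x in cellI dx i) ((Q i).[x] * (Q i).[x]))
     - (\int[leb]_(x in cellI dx i) ((- gfun a (U i).[x]) * ((Q i)^`()).[x]))
     + hhat_q dx a c12 U Q (i + 1) * (Q i).[xg dx (i + 1)]
     - hhat_q dx a c12 U Q i * (Q i).[xg dx i] = 0.

Let fc : continuous f. Proof. exact: bound_continuous flip. Qed.

Lemma cell_volume_terms i :
  (\int[leb]_(x in cellI dx i)
     ((f (U i).[x] - Num.sqrt (a (U i).[x]) * (Q i).[x]) * ((U i)^`()).[x]))
  + (\int[leb]_(x in cellI dx i) ((- gfun a (U i).[x]) * ((Q i)^`()).[x]))
  = (Fprim f (U i).[xg dx (i + 1)] - gfun a (U i).[xg dx (i + 1)] * (Q i).[xg dx (i + 1)])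
    - (Fprim f (U i).[xg dx i] - gfun a (U i).[xg dx i] * (Q i).[xg dx i]).
Proof.
have sc := sqrta_continuous ac.
have ch (p : {poly R}) : continuous (horner p) by exact: continuous_horner.
have dg x : is_derive x (1 : R) (gfun a) (Num.sqrt (a x)) by exact: is_derive_int0.
have gc : continuous (gfun a).
  by move=> x; apply/differentiable_continuous/derivable1_diffP; case: (dg x).
have c1 : continuous (fun x => (f (U i).[x] - Num.sqrt (a (U i).[x]) * (Q i).[x]) * ((U i)^`()).[x]).
  move=> x; apply: cvgM; last exact: ch.
  apply: cvgB; first by apply: (@continuous_comp _ _ _ (horner (U i)) f); [exact: ch|exact: fc].
  apply: cvgM; last exact: ch.
  by apply: (@continuous_comp _ _ _ (horner (U i)) (fun s => Num.sqrt (a s))); [exact: ch|exact: sc].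
have c2 : continuous (fun x => (- gfun a (U i).[x]) * ((Q i)^`()).[x]).
  move=> x; apply: cvgM; last exact: ch.
  by apply: cvgN; apply: (@continuous_comp _ _ _ (horner (U i)) (gfun a)); [exact: ch|exact: gc].
rewrite -RintegralD//; [|exact: measurable_itv|exact: continuous_integrable_itv|
   exact: continuous_integrable_itv].
apply: (@Rintegral_oo_FTC _ (fun x => Fprim f (U i).[x] - gfun a (U i).[x] * (Q i).[x])).
- by rewrite xgS ltrDl.
- move=> x.
  have dF : is_derive x (1 : R) (Fprim f \o horner (U i)) (f (U i).[x] * ((U i)^`()).[x]).
    by apply: is_derive1_comp; try exact: is_derive_horner; exact: is_derive_int0.
  have dgU : is_derive x (1 : R) (gfun a \o horner (U i)) (Num.sqrt (a (U i).[x]) * ((U i)^`()).[x]).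
    by apply: is_derive1_comp; try exact: is_derive_horner; exact: dg.
  have dQ := is_derive_horner (Q i) x.
  apply: (is_derive_eq (is_deriveB dF (is_deriveM dgU dQ))).
  by rewrite /= -![_ *: _]/(_ * _) ; ring.
- by move=> x; apply: cvgD; [exact: c1|exact: c2].
Qed.

(** Testing leaves left traces at the right end of the cell. Exchanging them for right traces costs
    the quadratic form at i + 1 and makes the right-hand side telescope. *)
Lemma cell_energy i :
  (\int[leb]_(x in cellI dx i) ((V i).[x] * (U i).[x]))
  + (\int[leb]_(x in cellI dx i) ((Q i).[x] * (Q i).[x])) + (-1) * B i
  + quadC dx f fhat c12 U Q (i + 1)
  = flux_potential i (trP dx U i) (trP dx Q i)
    - flux_potential (i + 1) (trP dx U (i + 1)) (trP dx Q (i + 1)).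
Proof.
have := flux_potential_jump (i + 1).
rewrite /flux_potential /trM /trP addrK => e.
have e1 := eq_u i; have e2 := eq_q i; have e3 := cell_volume_terms i.
by lra.
Qed.

Theorem jump_energy_le Binf : VkL2 dx k U -> VkL2 dx k V -> VkL2 dx k Q ->
  cell_sum B N @[N --> \oo] --> Binf ->
  (\esum_(i in [set: int]) (quadC dx f fhat c12 U Q i)%:E <=
   (Binf - L2ip (evV dx V) (evV dx U) - L2ip (evV dx Q) (evV dx Q))%:E)%E.
Proof.
move=> hU hV hQ cB; apply: esum_int_le.
  move=> i; rewrite /quadC /=.
  set um := trM dx U i; set up := trP dx U i.
  have := c11_jump_ge0 flip hcons hmono1 hmono2 um up.
  by rewrite expr2; lra.
pose P i := flux_potential i (trP dx U i) (trP dx Q i).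
have [P1 P2] := cvg_flux_potential hU hQ.
have cP : P (- N%:Z) - P N%:Z @[N --> \oo] --> 0 - 0.
  rewrite -cvg_shiftS; exact: cvgB.
have : (P (- N%:Z) - P N%:Z) + cell_sum B N
   - cell_sum (fun i => \int[leb]_(x in cellI dx i) ((V i).[x] * (U i).[x])) N
   - cell_sum (fun i => \int[leb]_(x in cellI dx i) ((Q i).[x] * (Q i).[x])) N @[N --> \oo]
   --> 0 - 0 + Binf - L2ip (evV dx V) (evV dx U) - L2ip (evV dx Q) (evV dx Q).
  apply: cvgB; last exact: cvg_cell_sum_L2ip.
  by apply: cvgB; [exact: cvgD|exact: cvg_cell_sum_L2ip].
rewrite subr0 add0r; apply: cvg_trans; apply: near_eq_cvg; apply: nearW => N /=.
rewrite -cell_sum_telescope.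
rewrite -(@eq_cell_sum _ _ _ N cell_energy) cell_sumD cell_sumD cell_sumD cell_sumZ.
by rewrite /=; ring.
Qed.

End EnergyBalance.

(** * The fractional kernel *)

Section PowerIntegrals.
Variable R : realType.
Local Notation leb := (@lebesgue_measure R).

(* Only the increments of the primitive on the open domain enter, so f may be
   singular at the end points. *)
Lemma integral_exhaustion_le (D : set R) (c d : nat -> R) (f F : R -> R) (B : R) :
  {homo (fun n => `[c n, d n]%classic : set R) : n m / (n <= m)%N >-> (n <= m)%O} ->
  \bigcup_n `[c n, d n]%classic = D ->
  (forall x, D x -> is_derive x (1 : R) F (f x)) ->
  (forall x, D x -> {for x, continuous f}) ->
  (forall x, D x -> 0 <= f x) ->
  (forall x y, D x -> D y -> x <= y -> F y - F x <= B) -> 0 <= B ->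
  (\int[leb]_(x in D) (f x)%:E <= B%:E)%E.
Proof.
move=> nd cupD dF cf f0 FB B0.
have sub n x : c n <= x <= d n -> D x.
  by move=> h; rewrite -cupD; exists n => //=; rewrite in_itv.
have cfw n : {within `[c n, d n], continuous f}.
  by apply: continuous_in_subspaceT => x; rewrite inE /= in_itv /= => /sub; exact: cf.
have mf n : measurable_fun `[c n, d n] (EFin \o f).
  apply/measurable_EFinP; apply: subspace_continuous_measurable_fun => //.
have cv : (\int[leb]_(x in `[c n, d n]) (f x)%:E @[n --> \oo] --> \int[leb]_(x in D) (f x)%:E)%E.
  rewrite -cupD; apply: ge0_nondecreasing_set_cvg_integral => //.
  by move=> n x /=; rewrite in_itv /= => /sub; rewrite lee_fin; exact: f0.
rewrite -(cvg_lim _ cv)//; apply: lime_le; first by apply/cvg_ex; eexists; exact: cv.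
(* The first intervals of an exhaustion may be empty or a single point, as happens for ]a, b[ shrunk
   by 1/(n+1) at both ends. *)
apply: nearW => n; have [cd|dc] := ltP (c n) (d n); last first.
  apply: le_trans (_ : (\int[leb]_(x in [set c n]) (f x)%:E <= _)%E).
    have [cd|cd] := eqVneq (c n) (d n); first by rewrite -cd set_itv1.
    by rewrite set_itv_ge ?integral_set0 ?integral_set1// bnd_simp -ltNge lt_neqAle eq_sym cd.
  by rewrite integral_set1 lee_fin.
have dF' x : x \in `[c n, d n] -> derivable F x 1 by rewrite in_itv => /sub /dF; case.
have cF x : c n <= x <= d n -> {for x, continuous F}.
  by move=> /sub /dF [h _]; exact/differentiable_continuous/derivable1_diffP.
rewrite (@continuous_FTC2 _ f F)//.
- rewrite -EFinB lee_fin; apply: FB; rewrite ?(ltW cd)//; apply: (@sub n);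
  by rewrite lexx (ltW cd).
- split.
  + by move=> x; rewrite in_itv /= => /andP[x1 x2]; apply: dF'; rewrite in_itv /= !ltW.
  + by apply: cvg_at_right_filter; apply: cF; rewrite lexx ltW.
  + by apply: cvg_at_left_filter; apply: cF; rewrite lexx ltW.
- move=> x; rewrite in_itv /= => /andP[x1 x2]; have Dx : D x by apply: (@sub n); rewrite !ltW.
  by rewrite derive1E; case: (dF x Dx).
Qed.

Lemma bigcup_cc_cy (a : R) : \bigcup_n `[a, a + n%:R]%classic = `[a, +oo[%classic.
Proof.
apply/seteqP; split => x /=.
  by move=> [n _ /=]; rewrite !in_itv /= andbT => /andP[].
rewrite in_itv /= andbT => ax; exists (Num.trunc (x - a)).+1 => //=.
rewrite in_itv /= ax /= -lerBlDl ltW// truncnS_gt//.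
Qed.

Lemma bigcup_cc_Nyc (a : R) : \bigcup_n `[a - n%:R, a]%classic = `]-oo, a]%classic.
Proof.
apply/seteqP; split => x /=.
  by move=> [n _ /=]; rewrite !in_itv /= => /andP[].
rewrite in_itv /= => ax; exists (Num.trunc (a - x)).+1 => //=.
by rewrite in_itv /= ax andbT lerBlDr -lerBlDl ltW// truncnS_gt.
Qed.

Lemma bigcup_cc_oo (a b : R) :
  \bigcup_n `[a + n.+1%:R^-1, b - n.+1%:R^-1]%classic = `]a, b[%classic.
Proof.
apply/seteqP; split => x /=.
  move=> [n _ /=]; rewrite !in_itv /= => /andP[h1 h2].
  by rewrite (lt_le_trans _ h1) ?ltrDl ?invr_gt0// (le_lt_trans h2) ?gtrDl ?oppr_lt0 ?invr_gt0.
rewrite in_itv /= => /andP[ax xb].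
pose m := Num.min (x - a) (b - x); have m0 : 0 < m by rewrite lt_min !subr_gt0 ax.
exists (Num.trunc m^-1) => //=.
have h : (Num.trunc m^-1).+1%:R^-1 < m.
  by rewrite -[ltRHS]invrK ltf_pV2 ?posrE ?invr_gt0// truncnS_gt.
move: h; rewrite lt_min => /andP[h1 h2]; rewrite in_itv /=.
by rewrite -lerBrDl ltW//= lerBrDr -lerBrDl ltW.
Qed.

Lemma is_derive_powR_shift (a p z : R) : a < z ->
  is_derive z (1 : R) (fun z => powR (z - a) p) (p * powR (z - a) (p - 1)).
Proof.
move=> az.
have d1 : is_derive z (1 : R) (fun z : R => z - a) 1.
  by apply: (is_derive_eq (is_deriveB (is_derive_id z (1 : R)) (is_derive_cst a z (1 : R)))); rewrite subr0.
have d2 : is_derive (z - a) (1 : R) (@powR R ^~ p) (p * powR (z - a) (p - 1)).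
  by apply: is_derive1_powR; rewrite subr_gt0.
by have := @is_derive1_comp _ (@powR R ^~ p) (fun z => z - a) z _ _ d2 d1; rewrite mulr1.
Qed.

Lemma is_derive_powR_reflect (a p z : R) : z < a ->
  is_derive z (1 : R) (fun z => powR (a - z) p) (- (p * powR (a - z) (p - 1))).
Proof.
move=> az.
have d1 : is_derive z (1 : R) (fun z : R => a - z) (-1).
  by apply: (is_derive_eq (is_deriveB (is_derive_cst a z (1 : R)) (is_derive_id z (1 : R)))); rewrite sub0r.
have d2 : is_derive (a - z) (1 : R) (@powR R ^~ p) (p * powR (a - z) (p - 1)).
  by apply: is_derive1_powR; rewrite subr_gt0.
by have := @is_derive1_comp _ (@powR R ^~ p) (fun z => a - z) z _ _ d2 d1; rewrite mulrN1.
Qed.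

Lemma derivable_continuous (f : R -> R) x df : is_derive x (1 : R) f df -> {for x, continuous f}.
Proof. by case=> h _; exact/differentiable_continuous/derivable1_diffP. Qed.

Lemma powR_antimono (p x y : R) : 0 <= p -> 0 < x -> x <= y -> powR y (- p) <= powR x (- p).
Proof.
move=> p0 x0 xy; have y0 := lt_le_trans x0 xy.
rewrite !powRN lef_pV2 ?posrE ?powR_gt0//.
by apply: ge0_ler_powR; rewrite // nnegrE ltW.
Qed.

Section Exponent.
Variable lam : R.
Hypothesis lam01 : 0 < lam < 1.

Let lam0 : 0 < lam. Proof. by case/andP: lam01. Qed.
Let lam1 : 0 < 1 - lam. Proof. by rewrite subr_gt0; case/andP: lam01. Qed.
Let e1 : - lam - 1 = - (1 + lam). Proof. by ring. Qed.
Let e2 : 1 - lam - 1 = - lam. Proof. by ring. Qed.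

(** For lam in ]0, 1[ the value on the diagonal is 0, in agreement with division by zero in the
    definition of the seminorm. *)
Definition frac_kernel (x z : R) : R := powR `|z - x| (- (1 + lam)).

Lemma frac_kernelC x z : frac_kernel x z = frac_kernel z x.
Proof. by rewrite /frac_kernel distrC. Qed.

Lemma frac_kernel_ge0 x z : 0 <= frac_kernel x z.
Proof. exact: powR_ge0. Qed.

Lemma integral_kernel_right (x b : R) : x < b ->
  (\int[leb]_(z in `[b, +oo[) (frac_kernel x z)%:E <= (lam^-1 * powR (b - x) (- lam))%:E)%E.
Proof.
move=> xb.
have -> : (\int[leb]_(z in `[b, +oo[) (frac_kernel x z)%:E =
    \int[leb]_(z in `[b, +oo[) (powR (z - x) (- (1 + lam)))%:E)%E.
  apply: eq_integral => z; rewrite inE /= in_itv /= andbT => bz.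
  by rewrite /frac_kernel ger0_norm// subr_ge0 (le_trans (ltW xb)).
apply: (@integral_exhaustion_le _ (fun=> b) (fun n => b + n%:R) _
   (fun z => - lam^-1 * powR (z - x) (- lam))).
- move=> n m nm; apply/subsetPset => z /=; rewrite !in_itv /= => /andP[-> h].
  by rewrite (le_trans h)// lerD2l ler_nat.
- exact: bigcup_cc_cy.
- move=> z; rewrite /= in_itv /= andbT => bz.
  have xz := lt_le_trans xb bz.
  apply: (is_derive_eq (is_deriveZ (- lam^-1) (is_derive_powR_shift (- lam) xz))).
  by rewrite e1 /= -[_ *: _]/(_ * _) mulrA mulrNN mulVf ?mul1r// lt0r_neq0.
- move=> z; rewrite /= in_itv /= andbT => bz.
  by apply: derivable_continuous; exact: is_derive_powR_shift (lt_le_trans xb bz).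
- by move=> z _; exact: powR_ge0.
- move=> z y; rewrite /= !in_itv /= !andbT => bz _ _.
  have h := powR_antimono (ltW lam0) (_ : 0 < b - x) (_ : b - x <= z - x).
  have {h} : powR (z - x) (- lam) <= powR (b - x) (- lam).
    by apply: h; [rewrite subr_gt0|rewrite lerD2r].
  move=> h; have : lam^-1 * powR (z - x) (- lam) <= lam^-1 * powR (b - x) (- lam).
    by rewrite ler_wpM2l// invr_ge0 ltW.
  have : 0 <= lam^-1 * powR (y - x) (- lam) by rewrite mulr_ge0 ?powR_ge0// invr_ge0 ltW.
  by rewrite !mulNr; lra.
- by rewrite mulr_ge0 ?powR_ge0// invr_ge0 ltW.
Qed.

Lemma integral_kernel_left (x a : R) : a < x ->
  (\int[leb]_(z in `]-oo, a]) (frac_kernel x z)%:E <= (lam^-1 * powR (x - a) (- lam))%:E)%E.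
Proof.
move=> ax.
have -> : (\int[leb]_(z in `]-oo, a]) (frac_kernel x z)%:E =
    \int[leb]_(z in `]-oo, a]) (powR (x - z) (- (1 + lam)))%:E)%E.
  apply: eq_integral => z; rewrite inE /= in_itv /= => za.
  by rewrite /frac_kernel distrC ger0_norm// subr_ge0 (le_trans za (ltW ax)).
apply: (@integral_exhaustion_le _ (fun n => a - n%:R) (fun=> a) _
   (fun z => lam^-1 * powR (x - z) (- lam))).
- move=> n m nm; apply/subsetPset => z /=; rewrite !in_itv /= => /andP[h ->].
  by rewrite (le_trans _ h)// lerD2l lerN2 ler_nat.
- exact: bigcup_cc_Nyc.
- move=> z; rewrite /= in_itv /= => za.
  have zx := le_lt_trans za ax.
  apply: (is_derive_eq (is_deriveZ (lam^-1) (is_derive_powR_reflect (- lam) zx))).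
  by rewrite e1 /= -[_ *: _]/(_ * _) mulNr opprK mulrA mulVf ?mul1r// lt0r_neq0.
- move=> z; rewrite /= in_itv /= => za.
  by apply: derivable_continuous; exact: is_derive_powR_reflect (le_lt_trans za ax).
- by move=> z _; exact: powR_ge0.
- move=> z y; rewrite /= !in_itv /= => _ ya _.
  have h : powR (x - y) (- lam) <= powR (x - a) (- lam).
    by apply: powR_antimono; [exact: ltW|rewrite subr_gt0|rewrite lerD2l lerN2].
  have : lam^-1 * powR (x - y) (- lam) <= lam^-1 * powR (x - a) (- lam).
    by rewrite ler_wpM2l// invr_ge0 ltW.
  have : 0 <= lam^-1 * powR (x - z) (- lam) by rewrite mulr_ge0 ?powR_ge0// invr_ge0 ltW.
  by lra.
- by rewrite mulr_ge0 ?powR_ge0// invr_ge0 ltW.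
Qed.

(** The two kernel tails outside a cell ]a, b[ leave this weight in x. Its integrability at the cell
    ends is exactly where lam < 1 is needed. *)
Lemma integral_singularities (a b : R) : a < b ->
  (\int[leb]_(x in `]a, b[) (powR (x - a) (- lam) + powR (b - x) (- lam))%:E
   <= (2 * (1 - lam)^-1 * powR (b - a) (1 - lam))%:E)%E.
Proof.
move=> ab.
have i0 : 0 <= (1 - lam)^-1 by rewrite invr_ge0 ltW.
apply: (@integral_exhaustion_le _ (fun n => a + n.+1%:R^-1) (fun n => b - n.+1%:R^-1) _
   (fun x => (1 - lam)^-1 * powR (x - a) (1 - lam) - (1 - lam)^-1 * powR (b - x) (1 - lam))).
- move=> n m nm; apply/subsetPset => z /=; rewrite !in_itv /= => /andP[h1 h2].
  have h : m.+1%:R^-1 <= n.+1%:R^-1 :> R by rewrite lef_pV2 ?posrE// ler_nat.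
  by rewrite (le_trans _ h1) ?lerD2l// (le_trans h2)// lerD2l lerN2.
- exact: bigcup_cc_oo.
- move=> z; rewrite /= in_itv /= => /andP[az zb].
  apply: (is_derive_eq (is_deriveB
    (is_deriveZ ((1 - lam)^-1) (is_derive_powR_shift (1 - lam) az))
    (is_deriveZ ((1 - lam)^-1) (is_derive_powR_reflect (1 - lam) zb)))).
  rewrite e2 /= -![_ *: _]/(_ * _) mulrN opprK !mulrA mulVf ?mul1r// lt0r_neq0//.
- move=> z; rewrite /= in_itv /= => /andP[az zb].
  apply: cvgD.
    exact: (derivable_continuous (is_derive_powR_shift (- lam) az)).
  exact: (derivable_continuous (is_derive_powR_reflect (- lam) zb)).
- by move=> z _; rewrite addr_ge0 ?powR_ge0.
- move=> x y; rewrite /= !in_itv /= => /andP[ax xb] /andP[ay yb] _.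
  have le t : 0 <= t -> t <= b - a -> (1 - lam)^-1 * powR t (1 - lam) <= (1 - lam)^-1 * powR (b - a) (1 - lam).
    move=> t0 tb; rewrite ler_wpM2l//; apply: ge0_ler_powR; rewrite ?nnegrE ?(ltW lam1)//.
    exact: le_trans tb.
  have ge t : 0 <= (1 - lam)^-1 * powR t (1 - lam) by rewrite mulr_ge0 ?powR_ge0.
  have := le (y - a); have := le (b - x); have := ge (x - a); have := ge (b - y).
  rewrite !subr_ge0 !(ltW ay) !(ltW xb) lerD2r lerD2l lerN2 (ltW yb) (ltW ax) => ? ? /(_ isT isT) ? /(_ isT isT) ?.
  by lra.
- by rewrite !mulr_ge0 ?powR_ge0.
Qed.

End Exponent.

End PowerIntegrals.

(** * An integrable majorant of the Gagliardo form *)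

Section Nonlocal.
Variables (R : realType) (dx lam C : R) (k : nat) (U : int -> {poly R}).
Hypothesis dx0 : 0 < dx.
Hypothesis lam01 : 0 < lam < 1.
Hypothesis hU : VkL2 dx k U.
Hypothesis C0 : 0 <= C.
Hypothesis hC : forall i x y,
  xg dx i <= x <= xg dx (i + 1) -> xg dx i <= y <= xg dx (i + 1) ->
  (U i).[x] ^+ 2 <= C * cell_mass dx U i /\
  ((U i).[y] - (U i).[x]) ^+ 2 <= C * cell_mass dx U i * (y - x) ^+ 2.
Local Notation leb := (@lebesgue_measure R).
Local Notation leb2 := ((@lebesgue_measure R) \x (@lebesgue_measure R))%E.
Local Notation u := (evV dx U).
Local Notation cl := (cell_of dx).
Local Notation m := (cell_mass dx U).

Let m0 i : 0 <= m i. Proof. exact: cell_mass_ge0. Qed.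

Definition cell_pair (p : R * R) : int * int := (cl p.1, cl p.2).

Lemma measurable_cell_pair_fiber ij : measurable (cell_pair @^-1` [set ij]).
Proof.
case: ij => i j; rewrite (_ : _ @^-1` _ = (cl @^-1` [set i]) `*` (cl @^-1` [set j])).
  by apply: measurableX; exact: measurable_cell_of_fiber dx0 _.
by apply/seteqP; split => -[x z] /=; [case=> <- <-|move=> [<- <-]].
Qed.

Lemma measurable_frac_kernel :
  measurable_fun [set: R * R] (fun p : R * R => frac_kernel lam p.1 p.2).
Proof.
apply: (measurableT_comp (measurable_powR (- (1 + lam)))).
apply: (measurableT_comp (@normr_measurable R setT)).
by apply: measurable_funB.
Qed.

(* Away from the grid, m_(cell x) kappa(x, z) + m_(cell z) kappa(z, x) dominates
   the quadratic form of the Gagliardo seminorm: a Lipschitz bound inside a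
   cell, a sup bound for points of different cells. *)
Definition kappa (p : R * R) : R :=
  C * (if cl p.1 == cl p.2 then powR dx (1 - lam) else 2 * frac_kernel lam p.1 p.2).

(** Only the mass of the cell of x appears, so that it leaves the integral in z as a constant; the
    contribution of the cell of z is recovered by exchanging the variables in [sym_dominant]. *)
Definition dominant (p : R * R) : R := m (cl p.1) * kappa p.

Lemma kappa_ge0 p : 0 <= kappa p.
Proof. by rewrite /kappa mulr_ge0//; case: ifP => _; rewrite ?mulr_ge0 ?powR_ge0. Qed.

Lemma dominant_ge0 p : 0 <= dominant p.
Proof. by rewrite mulr_ge0 ?kappa_ge0. Qed.

Lemma measurable_kappa : measurable_fun [set: R * R] kappa.
Proof.
pose G (ij : int * int) (p : R * R) := C * (if ij.1 == ij.2 then powR dx (1 - lam)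
   else 2 * frac_kernel lam p.1 p.2).
apply: (@measurable_fun_countable_partition _ _ _ _ _ cell_pair G).
  exact: measurable_cell_pair_fiber.
move=> [i j]; rewrite /G /=; case: (i == j); apply: measurable_funM => //.
by apply: measurable_funM => //; exact: measurable_frac_kernel.
Qed.

Lemma measurable_dominant : measurable_fun [set: R * R] dominant.
Proof.
apply: measurable_funM; last exact: measurable_kappa.
apply: (@measurable_fun_countable_partition _ _ _ _ _ cell_pair (fun ij _ => m ij.1)) => //.
exact: measurable_cell_pair_fiber.
Qed.

(** The line is cut into the cell of x, where [kappa] is constant, and the two half-lines outside
    it, where [kappa] is a multiple of the kernel and x is at positive distance. *)
Lemma integral_kappa_le i x : cellI dx i x ->
  (\int[leb]_z (kappa (x, z))%:E <=
   (C * (powR dx (1 - lam) * dx + 2 * lam^-1 *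
     (powR (x - xg dx i) (- lam) + powR (xg dx (i + 1) - x) (- lam))))%:E)%E.
Proof.
move=> hx; have clx := cellI_cell_of dx0 hx.
move: hx; rewrite /cellI /= in_itv /=; set a := xg dx i; set b := xg dx (i + 1).
move=> /andP[ax xb].
have ab : a < b := lt_trans ax xb.
have bE : b = a + dx by rewrite /b xgS.
have mk : measurable_fun setT (fun z => (kappa (x, z))%:E).
  by apply/measurable_EFinP; exact: (measurable_fun_pair2 x measurable_kappa).
have mK : measurable_fun setT (fun z => (frac_kernel lam x z)%:E).
  by apply/measurable_EFinP; exact: (measurable_fun_pair2 x measurable_frac_kernel).
have k0 z : (0 <= (kappa (x, z))%:E)%E by rewrite lee_fin kappa_ge0.
have K0 z : (0 <= (frac_kernel lam x z)%:E)%E by rewrite lee_fin frac_kernel_ge0.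
have TE : [set: R] = (`]-oo, a[ `|` `[a, b[) `|` `[b, +oo[.
  apply/seteqP; split => // z _ /=; rewrite !in_itv /= andbT.
  by case: (ltP z a) => za; [left; left|case: (ltP z b) => zb; [left; right|right]].
(* Points at the left end of the cell still belong to it for [cell_of], hence the half-open
   condition. *)
have far z : ~ (a <= z < b) -> kappa (x, z) = C * 2 * frac_kernel lam x z.
  move=> h; rewrite /kappa /= clx; case: eqP => [e|_]; last by rewrite mulrA.
  by exfalso; apply: h; have /(hcellP dx0) := esym e; rewrite /hcell /= in_itv.
rewrite TE ge0_integral_setU//; first last.
- apply/disj_setPS => z /= [[]]; rewrite !in_itv /= ?andbT => h1 h2.
    by have := lt_trans (le_lt_trans h2 h1) ab; rewrite ltxx.
  by move: h1; rewrite ltNge h2 andbF.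
- exact: measurable_funS mk.
- by apply: measurableU.
rewrite ge0_integral_setU//; first last.
- by apply/disj_setPS => z /= []; rewrite !in_itv /= => h1 /andP[]; rewrite leNgt h1.
- exact: measurable_funS mk.
have i0 : 0 <= C * 2 by rewrite mulr_ge0.
have -> : C * (powR dx (1 - lam) * dx + 2 * lam^-1 * (powR (x - a) (- lam) + powR (b - x) (- lam))) =
  (C * 2 * (lam^-1 * powR (x - a) (- lam)) + C * powR dx (1 - lam) * dx) +
  C * 2 * (lam^-1 * powR (b - x) (- lam)) by ring.
rewrite !EFinD; apply: leeD; first apply: leeD.
- have -> : (\int[leb]_(z in `]-oo, a[) (kappa (x, z))%:E =
    \int[leb]_(z in `]-oo, a[) ((C * 2)%:E * (frac_kernel lam x z)%:E))%E.
    apply: eq_integral => z; rewrite inE /= in_itv /= => za.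
    by rewrite -EFinM far// => /andP[]; rewrite leNgt za.
  rewrite ge0_integralZl_EFin//; last exact: measurable_funS mK.
  rewrite [leRHS]EFinM; apply: lee_wpmul2l; first by rewrite lee_fin.
  apply: le_trans (integral_kernel_left lam01 ax).
  apply: ge0_subset_integral => //; first exact: measurable_funS mK.
  by move=> z /=; rewrite !in_itv /= => /ltW.
- have -> : (\int[leb]_(z in `[a, b[) (kappa (x, z))%:E =
    \int[leb]_(z in `[a, b[) (cst (C * powR dx (1 - lam))%:E z))%E.
    apply: eq_integral => z; rewrite inE /= => zab.
    have /(hcellP dx0) clz : hcell dx i z by [].
    by rewrite /kappa /= clx clz eqxx.
  have muI : (leb `[a, b[%classic = dx%:E)%E.
    by rewrite lebesgue_measure_itv /= lte_fin ab -EFinB bE addrAC subrr add0r.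
  by rewrite integral_cst// [X in (_ * X <= _)%E](_ : _ = dx%:E).
- have -> : (\int[leb]_(z in `[b, +oo[) (kappa (x, z))%:E =
    \int[leb]_(z in `[b, +oo[) ((C * 2)%:E * (frac_kernel lam x z)%:E))%E.
    apply: eq_integral => z; rewrite inE /= in_itv /= andbT => za.
    by rewrite -EFinM far// => /andP[_]; rewrite ltNge za.
  rewrite ge0_integralZl_EFin//; last exact: measurable_funS mK.
  rewrite [leRHS]EFinM; apply: lee_wpmul2l; first by rewrite lee_fin.
  exact: integral_kernel_right.
Qed.

(** The factor of m_i does not depend on i, so the sum over all cells is bounded by that factor
    times |u|^2. *)
Lemma integral_dominant_cell_le i :
  (\int[leb]_(x in cellI dx i) \int[leb]_z (dominant (x, z))%:E <=
   (m i * (C * (powR dx (1 - lam) * dx * dx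
      + 2 * lam^-1 * (2 * (1 - lam)^-1 * powR dx (1 - lam)))))%:E)%E.
Proof.
have l0 : 0 <= lam^-1 by rewrite invr_ge0; case/andP: lam01 => /ltW.
set a := xg dx i; set b := xg dx (i + 1).
have bE : b = a + dx by rewrite /b xgS.
have ab : a < b by rewrite bE ltrDl.
pose s x := powR (x - a) (- lam) + powR (b - x) (- lam).
have s0 x : 0 <= s x by rewrite addr_ge0 ?powR_ge0.
have ms : measurable_fun setT s.
  apply: measurable_funD; apply: (measurableT_comp (measurable_powR (- lam))).
    exact: measurable_funB.
  exact: measurable_funB.
have mF : measurable_fun setT (fun x => \int[leb]_z (dominant (x, z))%:E)%E.
  apply: (@measurable_fun_fubini_tonelli_F _ _ _ _ _ leb (fun p => (dominant p)%:E)).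
    by apply/measurable_EFinP; exact: measurable_dominant.
  by move=> p; rewrite lee_fin dominant_ge0.
pose A := powR dx (1 - lam) * dx.
have A0 : 0 <= A by rewrite mulr_ge0 ?powR_ge0 ?ltW.
apply: (@le_trans _ _ (\int[leb]_(x in cellI dx i)
   ((m i * C * A)%:E + (m i * C * (2 * lam^-1))%:E * (s x)%:E))%E).
  apply: ge0_le_integral => //.
  - exact: measurable_itv.
  - by move=> x _; apply: integral_ge0 => z _; rewrite lee_fin dominant_ge0.
  - exact: measurable_funS mF.
  - apply: emeasurable_funD => //; apply: emeasurable_funM => //.
    by apply/measurable_EFinP; exact: measurable_funS ms.
  - move=> x hx.
    have -> : (\int[leb]_z (dominant (x, z))%:E = (m i)%:E * \int[leb]_z (kappa (x, z))%:E)%E.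
      rewrite -ge0_integralZl_EFin//.
      + by apply: eq_integral => z _; rewrite -EFinM /dominant /= (cellI_cell_of dx0 hx).
      + by move=> z _; rewrite lee_fin kappa_ge0.
      + by apply/measurable_EFinP; exact: (measurable_fun_pair2 x measurable_kappa).
    apply: (@le_trans _ _ ((m i)%:E * (C * (A + 2 * lam^-1 * s x))%:E)%E).
      by rewrite lee_wpmul2l ?lee_fin//; exact: integral_kappa_le.
    by rewrite -!EFinM -EFinD lee_fin le_eqVlt; apply/orP; left; apply/eqP; ring.
have mc : 0 <= m i * C by rewrite mulr_ge0.
rewrite ge0_integralD//; first last.
- by apply: emeasurable_funM => //; apply/measurable_EFinP; exact: measurable_funS ms.
- by move=> x _; rewrite -EFinM lee_fin !mulr_ge0.
- by move=> x _; rewrite lee_fin mulr_ge0.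
- exact: measurable_itv.
rewrite integral_cst; last exact: measurable_itv.
rewrite ge0_integralZl_EFin//; first last.
- by rewrite !mulr_ge0.
- by apply/measurable_EFinP; exact: measurable_funS ms.
- by move=> x _; rewrite lee_fin.
- exact: measurable_itv.
have muI : (leb (cellI dx i) = dx%:E)%E.
  by rewrite /cellI -/a -/b lebesgue_measure_itv /= lte_fin ab -EFinB bE addrAC subrr add0r.
rewrite [X in ((m i * C * A)%:E * X + _ <= _)%E](_ : _ = dx%:E)// -EFinM.
have -> : m i * (C * (powR dx (1 - lam) * dx * dx + 2 * lam^-1 * (2 * (1 - lam)^-1 * powR dx (1 - lam)))) =
  m i * C * A * dx + (m i * C * (2 * lam^-1)) * (2 * (1 - lam)^-1 * powR dx (1 - lam)).
  by rewrite /A; ring.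
rewrite EFinD leeD2l// [leRHS]EFinM; apply: lee_wpmul2l; first by rewrite lee_fin !mulr_ge0.
have := integral_singularities lam01 ab.
by rewrite {3}bE addrAC subrr add0r.
Qed.

Lemma integral_dominant_lty : (\int[leb]_x \int[leb]_z (dominant (x, z))%:E < +oo)%E.
Proof.
set W := C * (powR dx (1 - lam) * dx * dx
      + 2 * lam^-1 * (2 * (1 - lam)^-1 * powR dx (1 - lam))).
have W0 : 0 <= W.
  case/andP: lam01 => l0 l1.
  by rewrite /W mulr_ge0// addr_ge0// !mulr_ge0 ?powR_ge0 ?invr_ge0 ?subr_ge0 ?(ltW dx0) ?(ltW l0) ?(ltW l1).
have mF : measurable_fun setT (fun x => \int[leb]_z (dominant (x, z))%:E)%E.
  apply: (@measurable_fun_fubini_tonelli_F _ _ _ _ _ leb (fun p => (dominant p)%:E)).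
    by apply/measurable_EFinP; exact: measurable_dominant.
  by move=> p; rewrite lee_fin dominant_ge0.
pose l := L2ip u u.
apply: (@le_lt_trans _ _ (l * W)%:E); last by rewrite ltry.
apply: (ge0_integral_le_cell_sum dx0) => //.
  by move=> x; apply: integral_ge0 => z _; rewrite lee_fin dominant_ge0.
move=> N; apply: (@le_trans _ _ (cell_sum m N * W)%:E); last first.
  rewrite lee_fin ler_wpM2r//.
  have c := cvg_cell_sum_mass dx0 hU.
  rewrite /l -(cvg_lim _ c)//; apply: nondecreasing_cvgn_le; last by apply/cvg_ex; eexists; exact: c.
  by apply/nondecreasing_seqP => n; rewrite /cell_sum big_ord_recr /= lerDl addr_ge0.
rewrite /cell_sum mulr_suml -sumEFin; apply: lee_sum => n _.
by rewrite mulrDl EFinD leeD//; exact: integral_dominant_cell_le.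
Qed.

Definition sym_dominant (p : R * R) : R := dominant p + dominant (p.2, p.1).

Lemma integrable_sym_dominant : leb2.-integrable setT (EFin \o sym_dominant).
Proof.
have mE : measurable_fun [set: R * R] (EFin \o dominant).
  by apply/measurable_EFinP; exact: measurable_dominant.
have ms : measurable_fun [set: R * R] (fun p : R * R => (dominant (p.2, p.1))%:E).
  apply/measurable_EFinP; apply: (measurableT_comp measurable_dominant).
  by apply: measurable_fun_pair.
have i1 : leb2.-integrable setT (EFin \o dominant).
  apply/integrable12ltyP => //.
  rewrite (_ : (\int[_]_x _ = \int[leb]_x \int[leb]_z (dominant (x, z))%:E)%E) ?integral_dominant_lty//.
  by apply: eq_integral => x _; apply: eq_integral => z _ /=; rewrite ger0_norm ?dominant_ge0.
have i2 : leb2.-integrable setT (fun p : R * R => (dominant (p.2, p.1))%:E).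
  apply/integrable21ltyP => //.
  rewrite (_ : (\int[_]_y _ = \int[leb]_x \int[leb]_z (dominant (x, z))%:E)%E) ?integral_dominant_lty//.
  by apply: eq_integral => x _; apply: eq_integral => z _ /=; rewrite ger0_norm ?dominant_ge0.
rewrite (_ : EFin \o sym_dominant = (EFin \o dominant) \+ (fun p : R * R => (dominant (p.2, p.1))%:E))%E.
  exact: integrableD.
by apply/funext => p /=; rewrite EFinD.
Qed.

End Nonlocal.

(** * Convergence of the cellwise nonlocal terms to the seminorm *)

Section NonlocalLimit.
Variables (R : realType) (dx lam C : R) (k : nat) (U : int -> {poly R}).
Hypothesis dx0 : 0 < dx.
Hypothesis lam01 : 0 < lam < 1.
Hypothesis hU : VkL2 dx k U.
Hypothesis C0 : 0 <= C.
Hypothesis hC : forall i x y,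
  xg dx i <= x <= xg dx (i + 1) -> xg dx i <= y <= xg dx (i + 1) ->
  (U i).[x] ^+ 2 <= C * cell_mass dx U i /\
  ((U i).[y] - (U i).[x]) ^+ 2 <= C * cell_mass dx U i * (y - x) ^+ 2.
Local Notation leb := (@lebesgue_measure R).
Local Notation leb2 := ((@lebesgue_measure R) \x (@lebesgue_measure R))%E.
Local Notation u := (evV dx U).
Local Notation cl := (cell_of dx).
Local Notation m := (cell_mass dx U).
Local Notation K := (frac_kernel lam).

Let m0 i : 0 <= m i. Proof. exact: cell_mass_ge0. Qed.

(** At a grid point [ext_cell] is 0 for every cell whereas [evV] takes the value from the right; the
    decomposition of u into its cell pieces is therefore only an almost everywhere identity. *)
Definition off_grid (x : R) := cellI dx (cl x) x.

Lemma off_grid_xg x : ~ off_grid x -> range (xg dx) x.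
Proof.
move=> h; exists (cl x) => //.
have : hcell dx (cl x) x by apply/(hcellP dx0).
rewrite /hcell /= in_itv /= => /andP[]; rewrite le_eqVlt => /predU1P[//|h1 h2].
by exfalso; apply: h; rewrite /off_grid /cellI /= in_itv /= h1.
Qed.

Let ae2S (P Q : R * R -> Prop) : {ae leb2, forall p, P p} -> (forall p, P p -> Q p) ->
  {ae leb2, forall p, Q p}.
Proof.
by move=> [A [mA A0 sub]] h; exists A; split => // p /= nQ; apply: sub => /= /h.
Qed.

Lemma ae_off_grid : {ae leb2, forall p, off_grid p.1 /\ off_grid p.2}.
Proof.
have cG : countable (range (xg dx)) by apply: card_le_trans (card_image_le _ _) _; exact: countableP.
have mG : measurable (range (xg dx) : set R).
  by apply: countable_measurable.
have G0 : leb (range (xg dx)) = 0%E by exact: countable_lebesgue_measure0.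
have mA : measurable (range (xg dx) `*` [set: R]) by exact: measurableX.
have mB : measurable ([set: R] `*` range (xg dx)) by exact: measurableX.
exists ((range (xg dx) `*` setT) `|` (setT `*` range (xg dx))); split.
- exact: measurableU.
- apply: null_set_setU => //.
    by rewrite [LHS]product_measure1E// [X in (X * _)%E](_ : _ = 0%E)// mul0e.
  by rewrite [LHS]product_measure1E// [X in (_ * X)%E](_ : _ = 0%E)// mule0.
- move=> [x z] /= /not_andP[] h; [left|right]; split => //=; exact: off_grid_xg.
Qed.

Lemma ext_cell_off_grid i x : off_grid x ->
  ext_cell dx i (U i) x = if i == cl x then u x else 0.
Proof.
move=> hx; rewrite /ext_cell; case: eqP => [->|ne]; first by rewrite mem_set.
rewrite memNset// => /(cellI_cell_of dx0) e; exact: ne.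
Qed.

Lemma big_uniq_single (s : seq int) j (a : R) : uniq s ->
  \sum_(i <- s) (if i == j then a else 0) = if j \in s then a else 0.
Proof.
move=> us; rewrite -big_mkcond -big_filter; case: ifP => [js|/negbT js].
  by rewrite filter_pred1_uniq// big_seq1.
rewrite (_ : [seq _ <- s | _] = [::]) ?big_nil//.
apply/eqP; rewrite -size_eq0 size_filter; apply/eqP.
by apply/count_memPn.
Qed.

Lemma cell_sum_ext_cell N x : off_grid x ->
  cell_sum (fun i => ext_cell dx i (U i) x) N = if cl x \in window_seq N then u x else 0.
Proof.
move=> hx; rewrite cell_sum_window_seq -big_uniq_single ?uniq_window_seq//.
by apply: eq_bigr => i _; exact: ext_cell_off_grid.
Qed.

Let off_bound x : off_grid x -> u x ^+ 2 <= C * m (cl x).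
Proof.
move=> hx; rewrite (evV_cellI dx0 _ hx); move: hx; rewrite /off_grid /cellI /= in_itv /= => /andP[h1 h2].
have H : xg dx (cl x) <= x <= xg dx (cl x + 1) by rewrite !ltW.
exact: (hC H H).1.
Qed.

Let K0 x z : 0 <= K x z. Proof. exact: frac_kernel_ge0. Qed.

Lemma same_cell_bound x z : off_grid x -> off_grid z -> cl x = cl z ->
  (u z - u x) ^+ 2 * K x z <= C * m (cl x) * powR dx (1 - lam).
Proof.
move=> hx hz e; have [l0 l1] := andP lam01.
have hz' : cellI dx (cl x) z by rewrite e.
rewrite (evV_cellI dx0 _ hx) (evV_cellI dx0 _ hz').
move: (hx) hz'; rewrite /off_grid /cellI /= !in_itv /= => /andP[h1 h2] /andP[h3 h4].
have cm : 0 <= C * m (cl x) by rewrite mulr_ge0.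
have b : ((U (cl x)).[z] - (U (cl x)).[x]) ^+ 2 <= C * m (cl x) * (z - x) ^+ 2.
  by apply: (fun p q => (@hC _ x z p q).2); rewrite !ltW.
apply: (le_trans (ler_wpM2r (K0 x z) b)).
apply: (@le_trans _ _ (C * m (cl x) * ((z - x) ^+ 2 * K x z))); first by rewrite mulrA.
apply: ler_wpM2l => //.
have [->|xz] := eqVneq z x; first by rewrite subrr expr0n mul0r powR_ge0.
rewrite -(real_normK (num_real (z - x))) /frac_kernel; set t := `|z - x|.
have t0 : 0 < t by rewrite normr_gt0 subr_eq0.
rewrite -powR_mulrn ?(ltW t0)// -powRD; last by rewrite (lt0r_neq0 t0) implybT.
have -> : 2%:R + - (1 + lam) = 1 - lam by ring.
apply: ge0_ler_powR; rewrite ?nnegrE ?subr_ge0 ?(ltW l1) ?(ltW t0) ?(ltW dx0)//.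
by move: h2 h4; rewrite xgS /t => h2 h4; rewrite ler_norml; apply/andP; split; lra.
Qed.

(** [W] selects the cells that are kept. A single cell gives the terms of the scheme, all cells the
    seminorm, a window the partial sums, so one majorant serves all three. Within a cell the
    truncation acts equally on both points and the increment is either unchanged or 0. *)
Lemma truncated_form_bound (W : int -> bool) x z : off_grid x -> off_grid z ->
  `|((if W (cl z) then u z else 0) - (if W (cl x) then u x else 0)) * (u z - u x) * K x z|
  <= sym_dominant dx lam C U (x, z).
Proof.
move=> hx hz; rewrite /sym_dominant /dominant /kappa /=.
rewrite [cl x == cl z]eq_sym.
have d0 y A : 0 <= A -> 0 <= m (cl y) * (C * A) by move=> A0; rewrite !mulr_ge0.
have [e|ne] := eqVneq (cl z) (cl x).
  have H : (u z - u x) ^+ 2 * K x z <= m (cl x) * (C * powR dx (1 - lam)).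
    by rewrite mulrA (mulrC (m _)); exact: same_cell_bound.
  rewrite e; apply: (@le_trans _ _ (m (cl x) * (C * powR dx (1 - lam)))); last first.
    by rewrite lerDl d0// powR_ge0.
  case: (W (cl x)).
    by rewrite -expr2 ger0_norm// mulr_ge0// sqr_ge0.
  by rewrite subrr !mul0r normr0 d0// powR_ge0.
rewrite normrM (ger0_norm (K0 _ _)) (frac_kernelC lam z x).
have -> : m (cl x) * (C * (2 * K x z)) + m (cl z) * (C * (2 * K x z)) =
  (2 * (C * m (cl x)) + 2 * (C * m (cl z))) * K x z by ring.
rewrite ler_wpM2r//.
have := off_bound hx; have := off_bound hz.
set p := u z; set q := u x => hp hq.
have h (w : R) b : `|(if b then w else 0)| <= `|w| by case: b; rewrite ?normr0.
(* Truncation does not increase |u|, and (|p| + |q|)^2 <= 2 p^2 + 2 q^2; this is the factor 2 in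
   [kappa]. *)
rewrite normrM; apply: (@le_trans _ _ ((`|p| + `|q|) * (`|p| + `|q|))).
  apply: ler_pM => //; last exact: ler_normB.
  by rewrite (le_trans (ler_normB _ _))// lerD// h.
have := real_normK (num_real p); have := real_normK (num_real q).
have := sqr_ge0 (`|p| - `|q|); rewrite sqrrB -!expr2 sqrrD => ? e1 e2.
rewrite -e1 -e2 in hp hq *; lra.
Qed.

Definition pair_form i (p : R * R) : R :=
  (ext_cell dx i (U i) p.2 - ext_cell dx i (U i) p.1) * (u p.2 - u p.1) / powR `|p.2 - p.1| (1 + lam).

Definition gagliardo_form (p : R * R) : R :=
  (u p.2 - u p.1) ^+ 2 / powR `|p.2 - p.1| (1 + lam).

Let invK (p : R * R) : (powR `|p.2 - p.1| (1 + lam))^-1 = K p.1 p.2.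
Proof. by rewrite /frac_kernel powRN. Qed.

Lemma measurable_ext_cell i (q : {poly R}) : measurable_fun setT (ext_cell dx i q).
Proof.
rewrite (_ : ext_cell dx i q = horner q \_ (cellI dx i)); last first.
  by apply/funext => x; rewrite patchE.
apply/(measurable_restrictT _ _).1; first exact: measurable_itv.
exact: measurable_poly.
Qed.

Let mdiff (v : R -> R) : measurable_fun setT v ->
  measurable_fun [set: R * R] (fun p : R * R => v p.2 - v p.1).
Proof.
by move=> mv; apply: measurable_funB;
  [exact: (measurableT_comp mv measurable_snd)|exact: (measurableT_comp mv measurable_fst)].
Qed.

Let mK : measurable_fun [set: R * R] (fun p : R * R => (powR `|p.2 - p.1| (1 + lam))^-1).
Proof.
rewrite (_ : (fun p : R * R => _) = (fun p : R * R => K p.1 p.2)); last by apply/funext => p; rewrite invK.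
exact: measurable_frac_kernel.
Qed.

Lemma measurable_pair_form i : measurable_fun [set: R * R] (pair_form i).
Proof.
apply: measurable_funM mK; apply: measurable_funM; apply: mdiff.
  exact: measurable_ext_cell.
exact: measurable_evV.
Qed.

Lemma measurable_gagliardo_form : measurable_fun [set: R * R] gagliardo_form.
Proof.
apply: measurable_funM mK; apply: measurable_funX; apply: mdiff.
exact: measurable_evV.
Qed.

Lemma integrable_ae_dominated (f : R * R -> R) : measurable_fun [set: R * R] f ->
  {ae leb2, forall p, `|f p| <= sym_dominant dx lam C U p} ->
  leb2.-integrable setT (EFin \o f).
Proof.
move=> mf hf.
have mEf : measurable_fun [set: R * R] (EFin \o f) by apply/measurable_EFinP.
(* Applied to a constant sequence, for its conclusion that the limit is integrable: the bound is
   known only almost everywhere. *)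
have [] // := @dominated_convergence _ _ _ leb2 setT measurableT (fun=> EFin \o f) (EFin \o f)
  (EFin \o sym_dominant dx lam C U) (fun=> mEf) mEf.
- by apply: aeW => p _; exact: cvg_cst.
- exact: (integrable_sym_dominant dx0 lam01 hU C0).
- by apply: (ae2S hf) => p hp _ _ /=; rewrite lee_fin.
Qed.

Lemma integrable_pair_form i : leb2.-integrable setT (EFin \o pair_form i).
Proof.
apply: integrable_ae_dominated; first exact: measurable_pair_form.
apply: (ae2S ae_off_grid) => -[x z] [/= hx hz]; rewrite /pair_form invK /=.
rewrite !ext_cell_off_grid// ![i == _]eq_sym.
exact: (truncated_form_bound (fun j => j == i)).
Qed.

Lemma integrable_gagliardo_form : leb2.-integrable setT (EFin \o gagliardo_form).
Proof.
apply: integrable_ae_dominated; first exact: measurable_gagliardo_form.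
apply: (ae2S ae_off_grid) => -[x z] [/= hx hz]; rewrite /gagliardo_form invK /= expr2.
exact: (truncated_form_bound xpredT).
Qed.

Lemma HsemiE : Hsemi lam u = (\int[leb2]_p (gagliardo_form p)%:E)%E.
Proof.
by rewrite -(integral12_prod_meas1 integrable_gagliardo_form).
Qed.

Lemma Hsemi_fin_num : Hsemi lam u \is a fin_num.
Proof. by rewrite HsemiE; apply: integrable_fin_num => //; exact: integrable_gagliardo_form. Qed.

(** By Fubini the iterated integral is the integral of an integrable function on the plane, so
    [fine] loses nothing and the terms may be added. *)
Lemma intvLE c i : intvL lam c (ext_cell dx i (U i)) u =
  - (c / 2) * fine (\int[leb2]_p (pair_form i p)%:E)%E.
Proof. by rewrite -(integral12_prod_meas1 (integrable_pair_form i)). Qed.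

Lemma integrable_cell_sum_pair_form N :
  leb2.-integrable setT (fun p => (cell_sum (fun i => pair_form i p) N)%:E) /\
  (\int[leb2]_p (cell_sum (fun i => pair_form i p) N)%:E =
   (cell_sum (fun i => fine (\int[leb2]_p (pair_form i p)%:E)) N)%:E)%E.
Proof.
elim: N => [|N [IH1 IH2]].
  rewrite /cell_sum big_ord0; split.
    apply: (eq_integrable measurableT (cst 0%E)); last exact: integrable0.
    by move=> p _; rewrite big_ord0.
  by rewrite integral0_eq// => p _; rewrite big_ord0.
have fE i : (\int[leb2]_p (pair_form i p)%:E)%E \is a fin_num.
  by apply: integrable_fin_num => //; exact: integrable_pair_form.
have i2 : leb2.-integrable setT (fun p => ((pair_form N p)%:E + (pair_form (Negz N) p)%:E)%E).
  by apply: integrableD => //; exact: integrable_pair_form.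
have E : (fun p => (cell_sum (fun i => pair_form i p) N.+1)%:E) =
   (fun p => (cell_sum (fun i => pair_form i p) N)%:E +
     ((pair_form N p)%:E + (pair_form (Negz N) p)%:E))%E.
  by apply/funext => p; rewrite /cell_sum big_ord_recr /= !EFinD.
split; first by rewrite E; exact: integrableD.
rewrite E integralD// IH2 integralD//; [|exact: integrable_pair_form..].
rewrite /cell_sum big_ord_recr /= !EFinD !fineK//.
Qed.

(** In the sum only one of the two increments is truncated. As soon as the window contains the cells
    of x and z, the integrand equals the full Gagliardo form, so pointwise convergence is eventual
    equality. *)
Lemma cvg_cell_sum_pair_form :
  (\int[leb2]_p (cell_sum (fun i => pair_form i p) N)%:E @[N --> \oo] -->
   \int[leb2]_p (gagliardo_form p)%:E)%E.
Proof.
have sumE N x z : off_grid x -> off_grid z -> cell_sum (fun i => pair_form i (x, z)) N =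
   ((if cl z \in window_seq N then u z else 0) - (if cl x \in window_seq N then u x else 0))
   * (u z - u x) * K x z.
  move=> hx hz; rewrite -!cell_sum_ext_cell// -[K x z](invK (x, z)) /=.
  rewrite -mulrA; set B := _ / _; rewrite !cell_sum_window_seq.
  rewrite -sumrN -big_split mulr_suml; apply: eq_bigr => i _.
  by rewrite /pair_form /= -mulrA.
have [] // := @dominated_convergence _ _ _ leb2 setT measurableT
  (fun N p => (cell_sum (fun i => pair_form i p) N)%:E) (EFin \o gagliardo_form)
  (EFin \o sym_dominant dx lam C U).
- by move=> N; have [/integrableP[]] := integrable_cell_sum_pair_form N.
- by apply/measurable_EFinP; exact: measurable_gagliardo_form.
- apply: (ae2S ae_off_grid) => -[x z] [/= hx hz] _.
  apply: cvg_near_cst; exists (maxn `|cl x| `|cl z|).+1 => // N /= hN.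
  rewrite sumE// !mem_window_seq; first by rewrite /gagliardo_form invK expr2.
    by apply: leq_trans hN; rewrite ltnS leq_maxl.
  by apply: leq_trans hN; rewrite ltnS leq_maxr.
- exact: (integrable_sym_dominant dx0 lam01 hU C0).
- apply: (ae2S ae_off_grid) => -[x z] [/= hx hz] N _.
  rewrite lee_fin sumE//; exact: (truncated_form_bound (fun j => j \in window_seq N)).
Qed.

Lemma cvg_cell_sum_intvL c :
  cell_sum (fun i => intvL lam c (ext_cell dx i (U i)) u) N @[N --> \oo] -->
  - (c / 2) * fine (Hsemi lam u).
Proof.
have h := cvg_cell_sum_pair_form.
rewrite -(fineK Hsemi_fin_num) HsemiE fineK in h *; last by rewrite -HsemiE Hsemi_fin_num.
have h2 : fine (\int[leb2]_p (cell_sum (fun i => pair_form i p) N)%:E)%E @[N --> \oo] -->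
   fine (\int[leb2]_p (gagliardo_form p)%:E)%E.
  by apply: fine_cvg; rewrite fineK// -HsemiE Hsemi_fin_num.
have : - (c / 2) * fine (\int[leb2]_p (cell_sum (fun i => pair_form i p) N)%:E)%E @[N --> \oo] -->
   - (c / 2) * fine (\int[leb2]_p (gagliardo_form p)%:E)%E by apply: cvgMr; exact: h2.
apply: cvg_trans; apply: near_eq_cvg; apply: nearW => N /=.
rewrite (integrable_cell_sum_pair_form N).2 /= -cell_sumZ.
by apply: eq_cell_sum => i; rewrite intvLE.
Qed.

End NonlocalLimit.

Theorem nonlocal_energy (R : realType) (dx lam c : R) (k : nat) (U : int -> {poly R}) :
  0 < dx -> 0 < lam < 1 -> VkL2 dx k U ->
  Hsemi lam (evV dx U) \is a fin_num /\
  cell_sum (fun i => intvL lam c (ext_cell dx i (U i)) (evV dx U)) N @[N --> \oo] -->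
  - (c / 2) * fine (Hsemi lam (evV dx U)).
Proof.
move=> dx0 lam01 hU; have [C C0 hC] := cell_inverse_ineq k dx0.
have [Vk_U _] := hU; split.
  exact: (Hsemi_fin_num dx0 lam01 hU C0 (hC U Vk_U)).
exact: (cvg_cell_sum_intvL dx0 lam01 hU C0 (hC U Vk_U)).
Qed.

(** * Integration in time *)

Section LowerIntegral.
Import HBNNSimple.
Context d (T : measurableType d) (R : realType) (mu : {measure set T -> \bar R}).
Local Open Scope ereal_scope.

Definition minorant (D : set T) (f : T -> \bar R) (h : {nnsfun T >-> R}) :=
  forall x, (h x)%:E <= (f \_ D) x.

Lemma minorant_out (D : set T) f h x : minorant D f h -> ~ D x -> h x = 0%R.
Proof.
move=> m nD; have := m x; rewrite patchE memNset// lee_fin => hx.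
by apply/eqP; rewrite eq_le hx /=.
Qed.

Lemma minorant_le (D : set T) f h x : minorant D f h -> D x -> (h x)%:E <= f x.
Proof. by move=> m Dx; have := m x; rewrite patchE mem_set. Qed.

(* The integral of a nonnegative function is the supremum over its simple
   minorants, so these steps need no measurability of f. *)
Lemma ge0_integral_minorants_le (D : set T) (f : T -> \bar R) (c I : R) (X : \bar R) :
  (forall x, D x -> 0 <= f x) -> (0 <= c)%R -> 0 <= X ->
  (forall h, minorant D f h -> c%:E * \int[mu]_x (h x)%:E + X <= I%:E) ->
  c%:E * \int[mu]_(x in D) f x + X <= I%:E.
Proof.
move=> f0 c0 X0 H.
have h0 (h : {nnsfun T >-> R}) : 0 <= \int[mu]_x (h x)%:E.
  by apply: integral_ge0 => x _; rewrite lee_fin.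
have m0 : minorant D f nnsfun0.
  by move=> x; rewrite patchE; case: ifPn => // /set_mem; exact: f0.
have XI : X <= I%:E.
  by apply: le_trans (H _ m0); rewrite leeDr// mule_ge0// lee_fin.
have Xfin : X \is a fin_num.
  by rewrite ge0_fin_numE// (le_lt_trans XI)// ltry.
rewrite -leeBrDr//; have [->|cn0] := eqVneq c 0%R.
  by rewrite mul0e leeBrDr// add0e.
have cp : (0 < c)%R by rewrite lt_neqAle eq_sym cn0.
rewrite -lee_pdivlMl// ge0_integralE//.
apply: ge_ereal_sup => _ [h hm <-].
by rewrite -integralT_nnsfun lee_pdivlMl// leeBrDr//; exact: H.
Qed.

(** The three functions are replaced by simple minorants one after the other, the remaining two
    terms playing the part of the constant [X] each time. *)
Lemma ge0_integral_add3_minorants_le (D : set T) (f1 f2 f3 : T -> \bar R) (c1 c2 c3 I : R) :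
  (forall x, D x -> 0 <= f1 x) -> (forall x, D x -> 0 <= f2 x) -> (forall x, D x -> 0 <= f3 x) ->
  (0 <= c1)%R -> (0 <= c2)%R -> (0 <= c3)%R ->
  (forall h1 h2 h3, minorant D f1 h1 -> minorant D f2 h2 -> minorant D f3 h3 ->
    c1%:E * \int[mu]_x (h1 x)%:E + c2%:E * \int[mu]_x (h2 x)%:E
    + c3%:E * \int[mu]_x (h3 x)%:E <= I%:E) ->
  c1%:E * \int[mu]_(x in D) f1 x + c2%:E * \int[mu]_(x in D) f2 x
    + c3%:E * \int[mu]_(x in D) f3 x <= I%:E.
Proof.
move=> f10 f20 f30 c10 c20 c30 H.
have h0 c (h : {nnsfun T >-> R}) : (0 <= c)%R -> 0 <= c%:E * \int[mu]_x (h x)%:E.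
  by move=> c0; rewrite mule_ge0// integral_ge0// => x _; rewrite lee_fin.
have i0 c f : (0 <= c)%R -> (forall x, D x -> 0 <= f x) -> 0 <= c%:E * \int[mu]_(x in D) f x.
  by move=> c0 f0; rewrite mule_ge0// integral_ge0.
rewrite -addeA; apply: ge0_integral_minorants_le => //; first by rewrite adde_ge0// i0.
move=> h1 m1; rewrite addeCA; apply: ge0_integral_minorants_le => //; first by rewrite adde_ge0 ?h0 ?i0.
move=> h2 m2; rewrite addeA [X in X <= _]addeC; apply: ge0_integral_minorants_le => //.
  by rewrite adde_ge0 ?h0.
move=> h3 m3.
apply: le_trans (H _ _ _ m1 m2 m3); rewrite le_eqVlt; apply/orP; left; apply/eqP.
by rewrite addeC; exact: addeC.
Qed.

End LowerIntegral.

Section LowerIntegralInterval.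
Import HBNNSimple.

(** A combination of simple minorants is measurable, vanishes outside [0, T] and lies below G on ]0,
    T[; the two end points, where no inequality is assumed, form a null set. *)
Lemma integral_add3_le_itv (R : realType) (T : R) (f1 f2 f3 G : R -> \bar R) (c1 c2 c3 I : R) :
  (forall t, 0 <= f1 t)%E -> (forall t, 0 <= f2 t)%E -> (forall t, 0 <= f3 t)%E ->
  0 <= c1 -> 0 <= c2 -> 0 <= c3 ->
  measurable_fun `]0, T[ G ->
  (\int[@lebesgue_measure R]_(t in `]0%R, T[) G t = I%:E)%E ->
  (forall t, 0 < t < T -> (c1%:E * f1 t + c2%:E * f2 t + c3%:E * f3 t <= G t)%E) ->
  (c1%:E * \int[@lebesgue_measure R]_(t in `[0%R, T]) f1 t
   + c2%:E * \int[@lebesgue_measure R]_(t in `[0%R, T]) f2 t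
   + c3%:E * \int[@lebesgue_measure R]_(t in `[0%R, T]) f3 t <= I%:E)%E.
Proof.
move=> f10 f20 f30 c10 c20 c30 mG GI H.
apply: ge0_integral_add3_minorants_le => // h1 h2 h3 m1 m2 m3.
pose h t := c1 * h1 t + c2 * h2 t + c3 * h3 t.
have mh (g : {nnsfun measurableTypeR R >-> R}) : measurable_fun setT (EFin \o g).
  by apply/measurable_EFinP.
have mch c (g : {nnsfun measurableTypeR R >-> R}) : measurable_fun setT (fun t => c%:E * (g t)%:E)%E.
  by apply: emeasurable_funM => //; exact: mh.
have Hh t : ((h t)%:E = c1%:E * (h1 t)%:E + c2%:E * (h2 t)%:E + c3%:E * (h3 t)%:E)%E.
  by rewrite /h !EFinD !EFinM.
have mhh : measurable_fun setT (EFin \o h).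
  rewrite (_ : EFin \o h = fun t => (c1%:E * (h1 t)%:E + c2%:E * (h2 t)%:E + c3%:E * (h3 t)%:E)%E).
    apply: emeasurable_funD; last exact: (mch c3 h3).
    by apply: emeasurable_funD; [exact: (mch c1 h1)|exact: (mch c2 h2)].
  by apply/funext => t; rewrite /= Hh.
have ch0 c (g : {nnsfun measurableTypeR R >-> R}) t : 0 <= c -> (0 <= c%:E * (g t)%:E)%E.
  by move=> c0; rewrite -EFinM lee_fin mulr_ge0.
have -> : (c1%:E * \int[@lebesgue_measure R]_t (h1 t)%:E
   + c2%:E * \int[@lebesgue_measure R]_t (h2 t)%:E
   + c3%:E * \int[@lebesgue_measure R]_t (h3 t)%:E = \int[@lebesgue_measure R]_t (h t)%:E)%E.
  have E c (g : {nnsfun measurableTypeR R >-> R}) : 0 <= c ->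
      (c%:E * \int[@lebesgue_measure R]_t (g t)%:E = \int[@lebesgue_measure R]_t (c%:E * (g t)%:E))%E.
    move=> c0; rewrite ge0_integralZl_EFin//; first by move=> t _; rewrite lee_fin.
    exact: mh.
  have I2 : (\int[@lebesgue_measure R]_t (c1%:E * (h1 t)%:E + c2%:E * (h2 t)%:E) =
     \int[@lebesgue_measure R]_t (c1%:E * (h1 t)%:E) + \int[@lebesgue_measure R]_t (c2%:E * (h2 t)%:E))%E.
    by apply: ge0_integralD => //; try exact: mch; move=> t _; exact: ch0.
  rewrite !E// -I2; symmetry.
  transitivity (\int[@lebesgue_measure R]_t (c1%:E * (h1 t)%:E + c2%:E * (h2 t)%:E + c3%:E * (h3 t)%:E))%E; last first.
    apply: ge0_integralD => //; try exact: mch; try (by move=> t _; exact: ch0).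
      by move=> t _; rewrite adde_ge0 ?ch0.
    by apply: emeasurable_funD; exact: mch.
  by apply: eq_integral => t _; rewrite Hh.
have -> : (\int[@lebesgue_measure R]_t (h t)%:E = \int[@lebesgue_measure R]_(t in `[0%R, T]) (h t)%:E)%E.
  rewrite [RHS]integral_mkcond; apply: eq_integral => t _.
  rewrite patchE; case: ifPn => // /negP; rewrite inE => nt.
  by rewrite /h (minorant_out m1 nt) (minorant_out m2 nt) (minorant_out m3 nt) !mulr0 !addr0.
rewrite (@integral_itv_bndoo _ _ _ _ true false); last exact: measurable_funS mhh.
rewrite -GI; apply: ge0_le_integral => //.
- by move=> t _; rewrite lee_fin !addr_ge0// mulr_ge0.
- exact: measurable_funS mhh.
- move=> t; rewrite /= in_itv /= => tT.
  apply: le_trans (H t tT); rewrite Hh.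
  have inn : (`[0, T]%classic : set R) t.
    by rewrite /= in_itv /=; case/andP: tT => /ltW -> /ltW ->.
  by apply: leeD; [apply: leeD|]; apply: lee_wpmul2l; rewrite ?lee_fin//;
     [exact: minorant_le m1 inn|exact: minorant_le m2 inn|exact: minorant_le m3 inn].
Qed.

End LowerIntegralInterval.

(** * Initial energy and conclusion *)

(** Testing the projection with U itself gives (u0, U) = (U, U) after summation over the cells; then
    |u0 - U|^2 >= 0 expands to the claim. *)
Lemma projection_L2sq_le (R : realType) (dx : R) (k : nat) (u0 : R -> R) (U : int -> {poly R}) :
  0 < dx -> inL2 u0 -> VkL2 dx k U ->
  (forall (i : int) (v : {poly R}), (size v <= k.+1)%N ->
     (\int[@lebesgue_measure R]_(x in cellI dx i) ((U i).[x] * v.[x]))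
     = (\int[@lebesgue_measure R]_(x in cellI dx i) (u0 x * v.[x]))) ->
  ((L2ip (evV dx U) (evV dx U))%:E <= L2sq u0)%E.
Proof.
move=> dx0 hu0 hU proj; rewrite L2sqE// lee_fin.
have hu := VkL2_inL2 dx0 hU; have [VkU _] := hU.
have e : L2ip u0 (evV dx U) = L2ip (evV dx U) (evV dx U).
  have c1 := cvg_cell_sum_L2ip dx0 hU hU.
  have c2 := cvg_cell_sum_Rintegral dx0 (integrable_mul_L2 hu0 hu).
  rewrite -(cvg_lim _ c1)//; apply/esym/cvg_lim => //; apply: cvg_trans c2.
  apply: near_eq_cvg; apply: nearW => N; apply: eq_cell_sum => i.
  rewrite proj//; apply: eq_Rintegral => x; rewrite inE => hx.
  by rewrite (evV_cellI dx0 _ hx).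
have := L2ip_ge0 (fun x => u0 x + (-1) * evV dx U x).
by rewrite L2ip_expand// e; lra.
Qed.

Unset Implicit Arguments.

Theorem mainTheorem2 (R : realType) (dx T lam c b : R) (k : nat)
  (f a : R -> R) (fhat : R -> R -> R) (c12 : R -> R -> R -> R -> R)
  (u0 : R -> R) (U Ut Q Qt : R -> int -> {poly R}) :
  0 < dx -> 0 < T ->
  0 < lam < 1 -> 0 < c -> 0 <= b ->
  lipschitz f -> f 0 = 0 ->
  lipschitz a -> (forall s, 0 <= a s) -> (exists M : R, forall s, a s <= M) ->
  (* fhat: Lipschitz, consistent, monotone *)
  (exists L : R, forall x y x' y',
     `|fhat x y - fhat x' y'| <= L * (`|x - x'| + `|y - y'|)) ->
  (forall s, fhat s s = f s) ->
  (forall x x' y, x <= x' -> fhat x y <= fhat x' y) ->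
  (forall x y y', y <= y' -> fhat x y' <= fhat x y) ->
  (* c12: Lipschitz, vanishing when a = 0 or w^- = w^+ = 0 *)
  (exists L : R, forall p1 p2 p3 p4 r1 r2 r3 r4,
     `|c12 p1 p2 p3 p4 - c12 r1 r2 r3 r4|
       <= L * (`|p1 - r1| + `|p2 - r2| + `|p3 - r3| + `|p4 - r4|)) ->
  ((forall s, a s = 0) -> forall p1 p2 p3 p4, c12 p1 p2 p3 p4 = 0) ->
  c12 0 0 0 0 = 0 ->
  (* initial datum in L^2(R) *)
  inL2 u0 ->
  (* regularity: u, q in C^1([0,T]; V^k cap L^2) *)
  C1VkL2 dx k T U Ut -> C1VkL2 dx k T Q Qt ->
  LDG_solution dx T lam c b k f a fhat c12 u0 U Ut Q ->
  (L2sq (evV dx (U T))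
   + 2%:E * (\int[lebesgue_measure]_(t in `[0%R, T]) L2sq (evV dx (Q t)))
   + 2%:E * ThetaT dx T f fhat c12 U Q
   + (b * c)%:E * (\int[lebesgue_measure]_(t in `[0%R, T]) Hsemi lam (evV dx (U t)))
   <= L2sq u0)%E.
Proof.
move=> dx0 T0 lam01 c0 b0 /lipschitz_bound[Lf Lf0 flip] f00 /lipschitz_bound[La _ alip] a0 [M aM]
  [Lh hlip] hcons hmono1 hmono2 [Lc clip] _ c00 hu0 [UVk [Uq Uc]] [QVk _] [eq_u [eq_q eq_0]].
have ac : continuous a by exact: bound_continuous alip.
have aM' s : Num.sqrt (a s) <= Num.sqrt M by rewrite ler_wsqrtr.
(* The constants given for [fhat] and [c12] carry no sign, while the flux estimates need nonnegative
   ones. *)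
have hlip' x y x' y' : `|fhat x y - fhat x' y'| <= `|Lh| * (`|x - x'| + `|y - y'|).
  by rewrite (le_trans (hlip _ _ _ _))// ler_wpM2r ?addr_ge0// ler_norm.
have clip' p1 p2 p3 p4 r1 r2 r3 r4 : `|c12 p1 p2 p3 p4 - c12 r1 r2 r3 r4|
       <= `|Lc| * (`|p1 - r1| + `|p2 - r2| + `|p3 - r3| + `|p4 - r4|).
  by rewrite (le_trans (clip _ _ _ _ _ _ _ _))// ler_wpM2r ?addr_ge0// ler_norm.
have t0 : 0 <= (0 : R) <= T by rewrite lexx ltW.
have tT : 0 <= T <= T by rewrite lexx ltW.
have [mG GI] := @energy_FTC R T (fun t => evV dx (U t)) (fun t => evV dx (Ut t)) T0
  (fun t ht => VkL2_inL2 dx0 (UVk t ht).1) (fun t ht => VkL2_inL2 dx0 (UVk t ht).2) Uq Uc.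
have quad0 t i : 0 <= quadC dx f fhat c12 (U t) (Q t) i.
  rewrite /quadC /=; set um := trM _ _ _; set up := trP _ _ _.
  by have := c11_jump_ge0 flip hcons hmono1 hmono2 um up; rewrite expr2; lra.
rewrite (L2sqE (VkL2_inL2 dx0 (UVk T tT).1)).
apply: le_trans (projection_L2sq_le dx0 hu0 (UVk 0 t0).1 eq_0).
rewrite -!addeA addeA -addeA.
(* The final energy is split off, leaving E(0) - E(T), the integral of minus the energy rate, as the
   bound for the three time integrals. *)
apply: (@le_trans _ _ ((L2ip (evV dx (U T)) (evV dx (U T)))%:E +
   (L2ip (evV dx (U 0)) (evV dx (U 0)) - L2ip (evV dx (U T)) (evV dx (U T)))%:E)%E); last first.
  by rewrite -EFinD lee_fin addrC subrK.
rewrite leeD2l// addeA; apply: (integral_add3_le_itv _ _ _ _ _ _ mG GI) => //.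
- by move=> t; apply: integral_ge0 => x _; rewrite lee_fin sqr_ge0.
- by move=> t; apply: esum_ge0 => i _; rewrite lee_fin quad0.
- move=> t; apply: integral_ge0 => x _; apply: integral_ge0 => z _.
  by rewrite lee_fin divr_ge0 ?sqr_ge0 ?powR_ge0.
- by rewrite mulr_ge0// ltW.
move=> t tT'; have ht : 0 <= t <= T by case/andP: tT' => /ltW -> /ltW ->.
have [hU hV] := UVk t ht; have [hQ _] := QVk t ht; have [VkU _] := hU; have [VkQ _] := hQ.
have [Hfin Hcvg] := nonlocal_energy c dx0 lam01 hU.
have Bcvg : cell_sum (fun i => b * intvL lam c (ext_cell dx i (U t i)) (evV dx (U t))) N @[N --> \oo]
    --> b * (- (c / 2) * fine (Hsemi lam (evV dx (U t)))).
  rewrite (_ : (fun N => _) = (fun N => b * cell_sum (fun i => intvL lam c (ext_cell dx i (U t i)) (evV dx (U t))) N)).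
    by apply: cvgMr.
  by apply/funext => N; rewrite cell_sumZ.
have J := jump_energy_le dx0 Lf0 flip f00 ac (sqrtr_ge0 M) aM' (normr_ge0 Lh) hlip' hcons
  hmono1 hmono2 (normr_ge0 Lc) clip' c00 (fun i => eq_u t tT' i (U t i) (VkU i))
  (fun i => eq_q t tT' i (Q t i) (VkQ i)) hU hV hQ Bcvg.
rewrite (L2sqE (VkL2_inL2 dx0 hQ)) -(fineK Hfin).
(* Doubling matches the rate 2 (u_t, u) and turns the limit -(b c / 2) |u|^2 of the nonlocal terms
   into the coefficient b c of the claim. *)
have J2 := lee_wpmul2l (_ : (0 <= 2%:E :> \bar R)%E) J.
apply: le_trans (leeD (leeD (lexx _) (J2 _)) (lexx _)) _ => //.
by rewrite -!EFinM -!EFinD lee_fin; lra.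
Qed.
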